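(* Let $n\ge 2$ and $k\ge 1$. Each Whitney homology module $WH_j(A^*_{n,k})$, $0\le j\le k$, of subword order, and hence the sum $S_{(n-1,1)}^{\otimes j}\oplus S_{(n-1,1)}^{\otimes (j-1)}$ of two consecutive tensor powers of the reflection representation, has $h$-positive Frobenius characteristic, and in particular it is a permutation module. We have $\mathrm{ch}\,WH_0=h_n$, $\mathrm{ch}\,WH_1=h_1h_{n-1}$, and for $k\ge j\ge 2$ the $j$th Whitney homology of $A^*_{n,k}$ has Frobenius characteristic $$(h_1h_{n-1})*s_{(n-1,1)}^{*(j-1)}=\sum_{d=2}^{j}S(j-1,d-1)\,h_1^d h_{n-d}=\sum_{d=2}^{j}S^*(j,d)\,h_1^d h_{n-d}=h_1\,(h_1h_{n-2})^{*(j-1)},$$ a permutation module with orbits whose stabilisers are Young subgroups indexed by partitions of the form $(n-d,1^d)$, $d\ge 0$.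
   Context: $A^*_{n,k}$ is the poset of all words of length at most $k$ (including the empty word $\hat 0$) over an alphabet of size $n$, under subword order ($u\le v$ if $u$ is obtained from $v$ by deleting letters), with an artificial top element $\hat 1$ attached; the rank of a word is its length, and $S_n$ acts by permuting letters. The Whitney homology is $WH_j(P)=\bigoplus_{x:\,\mathrm{rank}(x)=j}\tilde H_{j-2}(\hat 0,x)$ with its natural $S_n$-action, where $\tilde H$ is reduced homology over $\mathbb{C}$ of the order complex of the open interval; $WH_0$ is the trivial module and $\tilde H_{-1}$ of the empty complex is $\mathbb{C}$. $S_\lambda$ is the irreducible $S_n$-module indexed by $\lambda$, with Frobenius characteristic the Schur function $s_\lambda$; $\mathrm{ch}$ is the Frobenius characteristic. $*$ is the internal (Kronecker) product of symmetric functions of the same degree, and $f^{*m}$ is the $m$-fold internal product; in the last expression the internal power is taken in degree $n-1$ and then multiplied (ordinary product) by $h_1$. $h_m$ is the complete homogeneous symmetric function, $h_0=1$, $h_m=0$ for $m<0$. ''$h$-positive'' means a nonnegative combination of the $h_\lambda$; a permutation module has a basis permuted by the group. $S(m,d)$ is the Stirling number of the second kind, and $S^*(j,d)$ is the number of set partitions of $\{1,\dots,j\}$ into $d$ blocks such that no block contains two consecutive integers. *)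

(* Defs.v *)
From HB Require Import structures.
From mathcomp Require Import all_boot all_order all_algebra all_fingroup.
From mathcomp Require Import all_solvable all_field all_character.
From mathcomp Require Import mpoly.
From mathcomp Require Import classical_sets reals complex.

Set Implicit Arguments.
Unset Strict Implicit.
Unset Printing Implicit Defensive.

Import Order.TTheory GRing.Theory Num.Theory.
Local Open Scope ring_scope.

(* Matrix representations act on row vectors on the right, matching the
   left-to-right composition of permutations, (s * t) x = t (s x). *)

Section PermutationRepresentation.

Variables (F : fieldType) (gT : finGroupType) (X : finType).
Variable to : {action gT &-> X}.

(* The free vector space on X; row vectors are indexed by enum_rank. *)
Definition perm_act_mx (g : gT) : 'M[F]_#|X| :=
  \matrix_(a, b) (to (enum_val a) g == enum_val b)%:R.

Lemma perm_act_mxl g m (A : 'M[F]_(#|X|, m)) a b :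
  (perm_act_mx g *m A) a b = A (enum_rank (to (enum_val a) g)) b.
Proof.
rewrite mxE (bigD1 (enum_rank (to (enum_val a) g))) //= mxE enum_rankK eqxx.
rewrite mul1r big1 ?addr0 // => c nc; rewrite mxE.
case: eqP => [e|_]; last by rewrite mul0r.
by rewrite e enum_valK eqxx in nc.
Qed.

Lemma perm_act_mxr g m (A : 'M[F]_(m, #|X|)) a b :
  (A *m perm_act_mx g) a b = A a (enum_rank (to (enum_val b) g^-1%g)).
Proof.
rewrite mxE (bigD1 (enum_rank (to (enum_val b) g^-1%g))) //= mxE enum_rankK.
rewrite actKV eqxx mulr1 big1 ?addr0 // => c nc; rewrite mxE.
case: eqP => [e|_]; last by rewrite mulr0.
by rewrite -e actK enum_valK eqxx in nc.
Qed.

Lemma perm_act_mx_repr : mx_repr [set: gT] perm_act_mx.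
Proof.
split=> [|g h _ _]; apply/matrixP => a b.
  by rewrite !mxE act1 (inj_eq enum_val_inj).
by rewrite perm_act_mxl !mxE enum_rankK actM.
Qed.

Definition perm_act_repr : mx_representation F [set: gT] #|X| :=
  MxRepresentation perm_act_mx_repr.

End PermutationRepresentation.

Section TensorPower.

Variables (F : fieldType) (gT : finGroupType).
Notation rep := (representation F [set: gT]).

Lemma triv_mx_repr : mx_repr [set: gT] (fun _ : gT => 1%:M : 'M[F]_1).
Proof. by split=> // g h _ _; rewrite mulmx1. Qed.

Definition triv_rep : rep := Representation (MxRepresentation triv_mx_repr).

Definition tensor_power (V : rep) (m : nat) : rep :=
  iter m (fun W : rep => Representation (prod_repr V W)) triv_rep.

Definition permuted_basis (V : rep) (B : 'M[F]_(rdegree V)) : Prop :=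
  B \in unitmx /\
  forall (g : gT) (i : 'I_(rdegree V)), exists j, row i B *m V g = row j B.

Definition is_permutation_module (V : rep) : Prop :=
  exists B, @permuted_basis V B.

End TensorPower.

Section WhitneyHomology.

Variables (F : fieldType) (gT : finGroupType).
Variables (disp : Order.disp_t) (P : finBPOrderType disp) (rk : P -> nat).
Variable to : {action gT &-> P}.
Hypothesis to_mono : forall g x y, (to x g < to y g)%O = (x < y)%O.
Hypothesis rk_inv : forall g x, rk (to x g) = rk x.

(* A pair (x, c) with x of rank j and c = (c_1 < ... < c_m) a chain of m
   elements of the open interval (\bot, x), i.e. an (m-1)-simplex of its order
   complex; the empty chain (m = 0) is the (-1)-simplex. *)
Definition is_interval_chain (j m : nat) (a : P * m.-tuple P) : bool :=
  (rk a.1 == j) && path <%O \bot%O (rcons a.2 a.1).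

Definition interval_chain (j m : nat) : predArgType := {a | @is_interval_chain j m a}.

Lemma interval_chain_act_proof j m (a : interval_chain j m) (g : gT) :
  @is_interval_chain j m (to (val a).1 g, map_tuple (to^~ g) (val a).2).
Proof.
have mono : {mono to^~ g : x y / (x < y)%O} by move=> x y; apply: to_mono.
have bot_fix : to \bot%O g = \bot%O.
  apply/eqP; rewrite -[_ == _]negbK -lt0x -(to_mono g^-1%g) actK.
  by rewrite ltx0.
have bot_lt y : (\bot < to y g)%O = (\bot < y)%O.
  by rewrite -[in LHS]bot_fix mono.
case: a => -[x c] /= /andP[/eqP <- cP].
rewrite /is_interval_chain /= rk_inv eqxx /= -map_rcons.
case: (rcons c x) cP => //= y s /andP[y0 sP].
by rewrite bot_lt y0 (mono_path mono).
Qed.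

Definition interval_chain_act j m (a : interval_chain j m) (g : gT) :
  interval_chain j m := Sub _ (interval_chain_act_proof a g).

Lemma interval_chain_is_action j m : is_action [set: gT] (@interval_chain_act j m).
Proof.
apply: is_total_action => [a | a g h]; apply: val_inj => /=.
  case: a => -[x c] /= _; rewrite act1; congr pair.
  by apply: val_inj => /=; rewrite (eq_map (g := id)) ?map_id // => y; apply: act1.
case: a => -[x c] /= _; rewrite actM; congr pair.
by apply: val_inj => /=; rewrite -map_comp; apply: eq_map => y /=; rewrite actM.
Qed.

Definition interval_chain_action j m : {action gT &-> interval_chain j m} :=
  Action (@interval_chain_is_action j m).

(* The chain group spanned by the pairs (x, c) is the direct sum, over all x of
   rank j, of the augmented chain groups of the order complexes of (\bot, x). *)
Definition chain_repr j m := perm_act_repr F (interval_chain_action j m).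

(* (x, c) |-> \sum_(i < m) (-1)^i (x, c minus its i-th element); it is 0 for
   m = 0, and the augmentation for m = 1. *)
Definition boundary j m :
    'M[F]_(#|interval_chain j m|, #|interval_chain j m.-1|) :=
  \matrix_(a < #|interval_chain j m|, b < #|interval_chain j m.-1|)
    let: (x, c) := val (enum_val a) in let: (y, e) := val (enum_val b) in
    \sum_(i < m)
      (-1) ^+ i * ((y == x) && (tval e == take i c ++ drop i.+1 c))%:R.

Lemma boundary_equivariant j m g :
  chain_repr j m g *m boundary j m = boundary j m *m chain_repr j m.-1 g.
Proof.
apply/matrixP => a b; rewrite perm_act_mxl perm_act_mxr !mxE !enum_rankK.
case: (enum_val a) => -[x c] ha /=; case: (enum_val b) => -[y e] hb /=.
apply: eq_bigr => i _; congr (_ * (_ && _)%:R).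
  by apply/eqP/eqP => [->|<-]; rewrite ?actK ?actKV.
rewrite -map_take -map_drop -map_cat.
apply/eqP/eqP => [->|<-]; rewrite -map_comp.
  by rewrite (eq_map (g := id)) ?map_id // => z /=; rewrite actK.
by rewrite (eq_map (g := id)) ?map_id // => z /=; rewrite actKV.
Qed.

Definition cycles j m := kermx (boundary j m).
Definition boundaries j m : 'M[F]_#|interval_chain j m| := <<boundary j m.+1>>%MS.

Lemma cycles_module j m : mxmodule (chain_repr j m) (cycles j m).
Proof.
apply/mxmoduleP => g _; apply/sub_kermxP.
by rewrite -mulmxA boundary_equivariant mulmxA mulmx_ker mul0mx.
Qed.

Lemma boundaries_module j m : mxmodule (chain_repr j m) (boundaries j m).
Proof.
rewrite (eqmx_module _ (genmxE _)); apply/mxmoduleP => g _.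
by rewrite -(boundary_equivariant j m.+1) submxMl.
Qed.

(* Cycles modulo boundaries on chains of m elements, that is, the direct sum of
   the reduced homology groups of degree m - 1 of the intervals (\bot, x) with
   rk x = j. *)
Definition interval_homology j m : representation F [set: gT] :=
  Representation (section_repr (boundaries_module j m) (cycles_module j m)).

(* WH_j takes reduced homology in degree j - 2, i.e. chains of j - 1 elements. *)
Definition whitney_homology (j : nat) : representation F [set: gT] :=
  if j is m.+1 then interval_homology m.+1 m else triv_rep F gT.

End WhitneyHomology.

(* Words of length at most k over 'I_n, with None as the artificial top. *)
Definition subword_poset (n k : nat) : predArgType := option (k.-bseq 'I_n).
HB.instance Definition _ n k := Finite.on (subword_poset n k).

Section SubwordOrder.

Variables n k : nat.
Implicit Types x y z : subword_poset n k.

Definition subword_le x y : bool :=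
  match x, y with
  | Some u, Some v => subseq u v
  | _, None => true
  | None, Some _ => false
  end.

Lemma subword_le_refl : reflexive subword_le.
Proof. by case=> //= u; apply: subseq_refl. Qed.

Lemma subword_le_anti : antisymmetric subword_le.
Proof.
move=> [u|] [v|] //= /andP[uv vu]; congr Some; apply: val_inj => /=.
apply/eqP; rewrite -(geq_leqif (size_subseq_leqif uv)).
exact: size_subseq vu.
Qed.

Lemma subword_le_trans : transitive subword_le.
Proof. by move=> [v|] [u|] [w|] //=; apply: subseq_trans. Qed.

Definition subword_rank x : nat := if x is Some u then size u else k.+1.

Definition subword_act x (g : 'S_n) : subword_poset n k :=
  omap (fun u : k.-bseq 'I_n => [bseq of map g u]) x.

Lemma subword_act_is_action : is_action [set: 'S_n] subword_act.
Proof.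
apply: is_total_action => [[u|]//|[u|]// g h] /=; congr Some; apply: val_inj => /=.
  by rewrite (eq_map (g := id)) ?map_id // => i; apply: perm1.
by rewrite -map_comp; apply: eq_map => i; rewrite permM.
Qed.

Definition subword_action : {action 'S_n &-> subword_poset n k} :=
  Action subword_act_is_action.

End SubwordOrder.

Fact subword_display : Order.disp_t. Proof. exact: Order.Disp tt tt. Qed.

HB.instance Definition _ n k :=
  Order.Le_isPOrder.Build subword_display (subword_poset n k)
    (@subword_le_refl n k) (@subword_le_anti n k) (@subword_le_trans n k).

Lemma subword_le0x n k (x : subword_poset n k) :
  (Some [bseq] <= x :> subword_poset n k)%O.
Proof. by case: x => //= u; apply: sub0seq. Qed.

HB.instance Definition _ n k :=
  Order.hasBottom.Build subword_display (subword_poset n k) (@subword_le0x n k).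

Lemma subword_lex1 n k (x : subword_poset n k) :
  (x <= None :> subword_poset n k)%O.
Proof. by case: x. Qed.

HB.instance Definition _ n k :=
  Order.hasTop.Build subword_display (subword_poset n k) (@subword_lex1 n k).

Lemma subword_act_mono n k (g : 'S_n) (x y : subword_poset n k) :
  (subword_action n k x g < subword_action n k y g)%O = (x < y)%O.
Proof.
have le_mono : {mono (subword_action n k)^~ g : x y / (x <= y)%O}.
  move=> [u|] [v|] //; apply/idP/idP => /= [uv|]; last exact: map_subseq.
  rewrite /Order.le /= -[val u](mapK (permK g)) -[val v](mapK (permK g)).
  exact: map_subseq.
exact: leW_mono le_mono x y.
Qed.

Lemma subword_rank_inv n k (g : 'S_n) (x : subword_poset n k) :
  subword_rank (subword_action n k x g) = subword_rank x.
Proof. by case: x => //= u; rewrite size_map. Qed.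

Definition subword_WH (F : fieldType) (n k j : nat) :
    representation F [set: 'S_n] :=
  whitney_homology F (@subword_act_mono n k) (@subword_rank_inv n k) j.

Section ReflectionRepresentation.

Variables (F : fieldType) (n : nat).

Definition natural_repr := perm_act_repr F ('P : {action 'S_n &-> 'I_n}).

Definition sum_zero : 'M[F]_#|'I_n| := kermx (const_mx 1 : 'cV[F]_#|'I_n|).

Lemma sum_zero_module : mxmodule natural_repr sum_zero.
Proof.
apply/mxmoduleP => g _; apply/sub_kermxP; rewrite -mulmxA.
suff -> : natural_repr g *m const_mx 1 = const_mx 1 :> 'cV[F]_#|'I_n|.
  exact: mulmx_ker.
by apply/matrixP => a b; rewrite perm_act_mxl !mxE.
Qed.

(* The module S_(n-1,1), as the sum-zero vectors of the natural permutation
   module. *)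
Definition reflection_rep : representation F [set: 'S_n] :=
  Representation (submod_repr sum_zero_module).

End ReflectionRepresentation.

(* w permutes each of the blocks {x | f x = i}, whose sizes are the parts of la
   (parts equal to 0 are harmless). *)
Definition is_young_subgroup (n : nat) (la : seq nat) (Y : {set 'S_n}) : Prop :=
  exists f : 'I_n -> nat,
    (forall i : nat, #|[set x | f x == i]| = nth 0%N la i) /\
    Y = [set w : 'S_n | [forall x, f (w x) == f x]].

Definition is_hook_permutation_module (F : fieldType) (n : nat)
    (V : representation F [set: 'S_n]) : Prop :=
  exists B, @permuted_basis F _ V B /\
    forall i, exists2 d : nat, (d <= n)%N
      & is_young_subgroup ((n - d)%N :: nseq d 1%N) (rstab V (row i B)).

(* Symmetric functions of degree n are represented by symmetric polynomials,
   homogeneous of degree n, in a number N >= n of variables. *)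
Section SymmetricFunctions.

Variables (F : fieldType) (N : nat).

Definition hsym (m : int) : {mpoly F[N]} :=
  if m is Posz d then \sum_(a : 'X_{1..N < d.+1} | mdeg a == d) 'X_[a] else 0.

Definition hsym_part (la : seq nat) : {mpoly F[N]} := \prod_(i <- la) hsym i%:Z.

Definition psum (m : nat) : {mpoly F[N]} := \sum_(i < N) 'X_i ^+ m.

(* Row and column indices start at 0; sumn la bounds the column indices. *)
Definition cell (la : seq nat) : predArgType :=
  {c : 'I_(size la) * 'I_(sumn la) | c.2 < nth 0 la c.1}%N.

Definition semistandard la (T : {ffun cell la -> 'I_N}) : bool :=
  [forall c : cell la, forall d : cell la,
    (((val c).1 == (val d).1) && ((val c).2 <= (val d).2)%N ==> (T c <= T d)%N)
    && (((val c).2 == (val d).2) && ((val c).1 < (val d).1)%N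
          ==> (T c < T d)%N)].

Definition schur (la : seq nat) : {mpoly F[N]} :=
  \sum_(T : {ffun cell la -> 'I_N} | semistandard T) \prod_c 'X_(T c).

Definition is_partition (n : nat) (la : seq nat) : bool :=
  [&& sorted geq la, 0%N \notin la & sumn la == n].

(* A combination of the h_la with coefficients in nat; for the Frobenius
   characteristic of a module nonnegative coefficients are integers. *)
Definition h_positive (n : nat) (f : {mpoly F[N]}) : Prop :=
  exists s : seq (nat * seq nat),
    all (fun t => is_partition n t.2) s /\
    f = \sum_(t <- s) t.1%:R *: hsym_part t.2.

(* (1/n!) \sum_w a(w) p_(cycle type of w) *)
Definition frob (n : nat) (a : {ffun 'S_n -> F}) : {mpoly F[N]} :=
  (n`!%:R)^-1 *: \sum_(w : 'S_n) a w *: \prod_(c in porbits w) psum #|c|.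

Definition ch (n : nat) (V : representation F [set: 'S_n]) : {mpoly F[N]} :=
  frob [ffun w => \tr (V w)].

Definition class_function (n : nat) (a : {ffun 'S_n -> F}) : Prop :=
  forall s t : 'S_n, a (s ^ t)%g = a s.

(* The class function with Frobenius characteristic f, unique for N >= n in
   characteristic 0. *)
Definition frob_inv (n : nat) (f : {mpoly F[N]}) : {ffun 'S_n -> F} :=
  xget 0 [set a : {ffun 'S_n -> F} | class_function a /\ frob a = f]%classic.

(* The internal product corresponds under ch to the pointwise product of class
   functions; equivalently p_la * p_mu = delta_(la,mu) z_la p_la. *)
Definition kron (n : nat) (f g : {mpoly F[N]}) : {mpoly F[N]} :=
  frob [ffun w => frob_inv n f w * frob_inv n g w].

(* h_n is the unit of the internal product in degree n. *)
Definition kron_pow (n : nat) (f : {mpoly F[N]}) (m : nat) : {mpoly F[N]} :=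
  iterop m (kron n) f (hsym n).

End SymmetricFunctions.

Definition stirling2 (m d : nat) : nat :=
  #|[set Q : {set {set 'I_m}} | finset.partition Q [set: 'I_m] & #|Q| == d]|.

Definition stirling2_star (m d : nat) : nat :=
  #|[set Q : {set {set 'I_m}} |
      [&& finset.partition Q [set: 'I_m], #|Q| == d
        & [forall B in Q, forall x in B, forall y in B, val y != (val x).+1]]]|.

(* Main.v *)
(* The top homology of the order complex of (\bot, x), for a word x of length j,
   is one-dimensional if x is a Smirnov word (no two adjacent letters are equal)
   and zero otherwise.  Existence: the map sending a set of positions to the
   corresponding subword of x pushes the fundamental cycle of the Boolean lattice
   forward to a cycle, whose coefficient at the chain of suffixes of a Smirnov word
   x is 1, because a Smirnov word is turned into its tail only by deleting the first
   letter.  Uniqueness: by induction on x = a t, a cycle vanishing on the chain of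
   suffixes vanishes, since between x and a Smirnov coatom a s the only words above
   s are a s and t.  The cycles are permuted without signs, so WH_j is the
   permutation module on Smirnov words, with character f (f - 1)^(j - 1), f being
   the number of fixed letters.

   The vectors (u_a (x) t, t), with t = (e_i1 - e_a) (x) ... (x) (e_im - e_a), no
   i_r equal to a, and u_a the projection of e_a to the sum-zero vectors, form a
   permuted basis of S^(m+1) + S^m, with the same character.

   The characteristic of a class function a is 1/n! times the sum of a(w) X^t over
   w and the words t with t o w = t.  This gives its injectivity (look at the word
   whose level sets are the cycles of w), and turns falling factorials of f into
   the products h_1^d h_(n-d).  Stirling numbers appear by sorting words according
   to the partition of their positions into level sets. *)

Require Import Defs.
From HB Require Import structures.
From mathcomp Require Import all_boot all_order all_algebra all_fingroup.
From mathcomp Require Import all_solvable all_field all_character.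
From mathcomp Require Import mpoly.
From mathcomp Require Import reals complex.

Set Implicit Arguments.
Unset Strict Implicit.
Unset Printing Implicit Defensive.

Import GRing.Theory Num.Theory.
Local Open Scope ring_scope.

(** * Words and set partitions *)

(** A function with kernel [Q] is an injection on the blocks of [Q] composed with the map from a
    position to its block, and the falling factorial counts these injections. *)
Lemma card_kernel_partition (m x : nat) (Q : {set {set 'I_m}}) :
    finset.partition Q [set: 'I_m] ->
  #|[set f : {ffun 'I_m -> 'I_x} | preim_partition f [set: 'I_m] == Q]|
    = (x ^_ #|Q|)%N.
Proof.
move=> pQ; have [/eqP covQ trivQ Q0] := and3P pQ.
have in_block i : pblock Q i \in Q by rewrite pblock_mem // covQ.
rewrite -[x in RHS]card_ord -[#|Q|]card_sig -card_inj_ffuns.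
pose blk i : {B | B \in Q} := exist _ (pblock Q i) (in_block i).
have blk_mem (B : {B | B \in Q}) i : i \in val B -> blk i = B.
  by move=> iB; apply: val_inj => /=; apply: def_pblock trivQ (valP B) iB.
have block_ne (B : {B | B \in Q}) : exists i, i \in val B.
  by apply/set0Pn; apply: contraNneq Q0 => <-; apply: valP.
pose F (h : {ffun {B | B \in Q} -> 'I_x}) := [ffun i => h (blk i)].
have F_inj : injective F.
  move=> h1 h2 /ffunP eqF; apply/ffunP => B; have [i iB] := block_ne B.
  by have := eqF i; rewrite !ffunE (blk_mem B).
rewrite -(card_imset _ F_inj); apply: eq_card => f; rewrite inE.
have kerP (g : {ffun 'I_m -> 'I_x}) : reflect (forall i j, (g i == g j) = (j \in pblock Q i))
    (preim_partition g [set: 'I_m] == Q).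
  apply: (iffP eqP) => [<- i j|eqg].
    rewrite pblock_equivalence_partition ?inE //; split=> //.
    by move=> /eqP->.
  rewrite -(equivalence_partition_pblock pQ).
  rewrite /preim_partition /equivalence_partition.
  by apply: eq_imset => i; apply/setP => j; rewrite !inE /= eqg.
apply/kerP/imsetP => [eqf|[h]]; last first.
  rewrite inE => /injectiveP h_inj -> i j; rewrite !ffunE (inj_eq h_inj).
  by rewrite -val_eqE /= eq_pblock ?covQ.
pose r (B : {B | B \in Q}) := xchoose (block_ne B).
exists [ffun B => f (r B)]; last first.
  apply/ffunP => i; rewrite !ffunE; apply/eqP; rewrite eqf.
  exact: (xchooseP (block_ne (blk i))).
rewrite inE; apply/injectiveP => B1 B2; rewrite !ffunE => /eqP; rewrite eqf.
move=> r2; rewrite -(blk_mem _ _ (xchooseP (block_ne B1))).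
apply/esym/val_inj => /=; rewrite -(def_pblock trivQ (valP B2) (xchooseP (block_ne B2))).
by apply: def_pblock (in_block _) _ => //; rewrite -def_pblock.
Qed.

(** Functions are sorted by kernel, then kernels by number of blocks. The condition [K] is trivial
    for [stirling2] and separates consecutive positions for [stirling2_star]. *)
Lemma card_by_kernel (m x : nat) (K : pred {set {set 'I_m}}) :
  #|[set f : {ffun 'I_m -> 'I_x} | K (preim_partition f [set: 'I_m])]|
    = (\sum_(d < m.+1)
         #|[set Q : {set {set 'I_m}} |
             [&& finset.partition Q [set: 'I_m], #|Q| == d & K Q]]| * x ^_ d)%N.
Proof.
rewrite -sum1_card.
under eq_bigl do rewrite inE.
rewrite (partition_big (fun f : {ffun 'I_m -> 'I_x} => preim_partition f [set: 'I_m])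
  (fun Q => finset.partition Q [set: 'I_m] && K Q)) /=; last first.
  by move=> f Kf; rewrite Kf preim_partitionP.
have card_le (Q : {set {set 'I_m}}) :
    finset.partition Q [set: 'I_m] -> (#|Q| < m.+1)%N.
  move=> pQ; rewrite ltnS -[X in (_ <= X)%N]card_ord -cardsT (card_partition pQ).
  rewrite -[X in (X <= _)%N]sum1_card; apply: leq_sum => B BQ; rewrite card_gt0.
  by apply: contraTneq BQ => ->; case/and3P: pQ.
(* The default value of [inord] is never taken: a partition of m points has at most m blocks, by
   [card_le]. *)
rewrite (partition_big (fun Q : {set {set 'I_m}} => inord #|Q| : 'I_m.+1) xpredT) //=.
apply: eq_bigr => d _; rewrite -sum1_card big_distrl /=.
apply: eq_big => [Q|Q /andP[/andP[pQ KQ] /eqP <-]].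
  rewrite inE; case pQ: (finset.partition Q _) => //=; rewrite andbC; congr andb.
  by rewrite -val_eqE /= inordK ?card_le.
rewrite mul1n inordK ?card_le // -card_kernel_partition // -sum1_card.
by apply: eq_bigl => f; rewrite inE; case: eqP => [->|]; rewrite ?KQ ?andbF.
Qed.

Lemma expn_stirling2 (m x : nat) :
  (x ^ m = \sum_(d < m.+1) stirling2 m d * x ^_ d)%N.
Proof.
have := card_by_kernel x (@predT {set {set 'I_m}}) => /= cardK.
have -> : (x ^ m = #|[set f : {ffun 'I_m -> 'I_x} | true]|)%N.
  by rewrite (eq_card (B := {ffun 'I_m -> 'I_x})) ?card_ffun ?card_ord // => f;
    rewrite !inE.
rewrite cardK; apply: eq_bigr => d _; congr (_ * _)%N.
by apply: eq_card => Q; rewrite !inE andbT.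
Qed.

Definition smirnov (T : eqType) (s : seq T) := sorted (fun a b => a != b) s.

Lemma big_tuple_cons (R : Type) (idx : R) (op : Monoid.com_law idx)
    (T : finType) (m : nat) (P : pred (seq T)) (F : seq T -> R) :
  \big[op/idx]_(t : m.+1.-tuple T | P t) F t =
  \big[op/idx]_(a : T) \big[op/idx]_(t : m.-tuple T | P (a :: t)) F (a :: t).
Proof.
rewrite pair_big_dep /=.
rewrite (reindex (fun p : T * m.-tuple T => [tuple of p.1 :: p.2])) //=.
exists (fun t : m.+1.-tuple T => (thead t, [tuple of behead t])) => [[a t] _|t _].
  by congr pair; apply: val_inj.
by rewrite -tuple_eta.
Qed.

Lemma card_tuple_cons (T : finType) (m : nat) (P : pred (seq T)) :
  #|[set t : m.+1.-tuple T | P t]| =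
  (\sum_(a : T) #|[set t : m.-tuple T | P (a :: t)]|)%N.
Proof.
rewrite -sum1_card; under eq_bigl do rewrite inE.
rewrite (big_tuple_cons _ _ P (fun=> 1%N)); apply: eq_bigr => a _.
by rewrite -sum1_card; apply: eq_bigl => t; rewrite inE.
Qed.

(** Each new letter may be any letter of [A] but the previous one. [A] is kept general because it
    will be the set of letters fixed by a permutation. *)
Lemma card_neq_path (T : finType) (A : {set T}) (m : nat) (a : T) : a \in A ->
  #|[set t : m.-tuple T | path (fun x y => x != y) a t && all (mem A) t]|
    = (#|A|.-1 ^ m)%N.
Proof.
elim: m a => [|m IHm] a aA.
  by rewrite (eq_card (B := [set: 0.-tuple T])) ?cardsT ?card_tuple // => t;
    rewrite !inE tuple0.
rewrite (card_tuple_cons _ (fun t => path _ a t && all (mem A) t)) /=.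
rewrite (bigID (mem (A :\ a))) /= [X in (_ + X)%N]big1 => [|b]; last first.
  rewrite !inE eq_sym negb_and => bP; apply: eq_card0 => t; rewrite inE.
  by case/orP: bP => /negPf->; rewrite ?andbF.
rewrite addn0 (eq_bigr (fun=> #|A|.-1 ^ m)%N) => [|b]; last first.
  rewrite !inE => /andP[ba bA]; rewrite -(IHm b bA); apply: eq_card => t.
  by rewrite !inE eq_sym ba bA.
by rewrite sum_nat_const (cardsD1 a A) aA expnS.
Qed.

Lemma card_smirnov (T : finType) (A : {set T}) (m : nat) :
  #|[set t : m.+1.-tuple T | smirnov t && all (mem A) t]|
    = (#|A| * #|A|.-1 ^ m)%N.
Proof.
rewrite (card_tuple_cons _ (fun t => smirnov t && all (mem A) t)).
rewrite (bigID (mem A)) /= [X in (_ + X)%N]big1 => [|b /negPf bA]; last first.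
  by apply: eq_card0 => t; rewrite inE bA andbF.
rewrite addn0 (eq_bigr (fun=> #|A|.-1 ^ m)%N) => [|b bA].
  by rewrite sum_nat_const.
by rewrite -(card_neq_path m bA); apply: eq_card => t; rewrite !inE bA.
Qed.

(** A word is a function on its positions, and whether it is Smirnov depends on its kernel only: no
    block may contain two consecutive positions. Both sides count these words. *)
Lemma smirnov_stirling2_star (m x : nat) :
  (x * x.-1 ^ m = \sum_(d < m.+2) stirling2_star m.+1 d * x ^_ d)%N.
Proof.
pose K (Q : {set {set 'I_m.+1}}) :=
  [forall B in Q, forall x in B, forall y in B, val y != (val x).+1].
transitivity #|[set f : {ffun 'I_m.+1 -> 'I_x} | K (preim_partition f [set: 'I_m.+1])]|;
  last exact: card_by_kernel.
have := card_smirnov [set: 'I_x] m; rewrite cardsT card_ord => <-.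
pose h (f : {ffun 'I_m.+1 -> 'I_x}) := [tuple f i | i < m.+1].
have h_inj : injective h.
  move=> f g eqh; apply/ffunP => i.
  by have := congr1 (fun t => tnth t i) eqh; rewrite !tnth_mktuple.
rewrite -(card_imset _ h_inj); apply: eq_card => t; rewrite inE.
have -> : all (mem [set: 'I_x]) t by apply/allP => i; rewrite inE.
rewrite andbT; pose f := [ffun i => tnth t i].
have -> : t = h f by apply: eq_from_tnth => i; rewrite tnth_mktuple ffunE.
rewrite (mem_imset _ _ h_inj) inE; move: f => {t}f.
have sz : size (h f) = m.+1 by rewrite size_tuple.
have nth_h i : (i < m.+1)%N -> nth (f ord0) (h f) i = f (inord i).
  move=> im; rewrite -[in LHS](inordK im) -tnth_nth tnth_mktuple //.
apply/(sortedP (f ord0))/idP => [sm|/forall_inP Kf i].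
  apply/forall_inP => B /imsetP[i _ ->]; apply/forall_inP => u.
  rewrite !inE /= => /eqP iu; apply/forall_inP => v; rewrite !inE /= => /eqP iv.
  apply/eqP => vu; have := sm u; rewrite sz -vu ltn_ord => /(_ isT).
  by rewrite !nth_h ?ltn_ord // !inord_val -iu -iv eqxx.
rewrite sz => im; rewrite !nth_h ?(ltnW im) //; apply/negP => /eqP fi.
have BP : [set v in [set: 'I_m.+1] | f (inord i) == f v]
    \in preim_partition f [set: 'I_m.+1] by apply/imsetP; exists (inord i).
have /forall_inP/(_ (inord i)) := Kf _ BP; rewrite !inE eqxx => /(_ isT)/forall_inP.
by move/(_ (inord i.+1)); rewrite !inE fi eqxx /= !inordK ?(ltnW im) // eqxx => /(_ isT).
Qed.

(** * The Frobenius characteristic *)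

Section Words.

Variables (F : fieldType) (N : nat).
Notation MP := {mpoly F[N]}.
Implicit Types s t : seq 'I_N.

Definition monom s : MP := \prod_(i <- s) 'X_i.
Definition content s : 'X_{1..N} := [multinom count_mem i s | i < N].
Definition weakly_increasing s := sorted (fun i j : 'I_N => (i <= j)%N) s.

Lemma monomE s : monom s = 'X_[content s].
Proof.
rewrite mpolyXE_id /monom; elim: s => [|i s IHs].
  by rewrite big_nil big1 // => i _; rewrite mnmE expr0.
rewrite big_cons IHs (bigD1 i) //= [RHS](bigD1 i) //= !mnmE /= eqxx exprS mulrA.
by congr (_ * _); apply: eq_bigr => j ji; rewrite !mnmE /= eq_sym (negPf ji).
Qed.

Lemma monom_cons i s : monom (i :: s) = 'X_i * monom s.
Proof. exact: big_cons. Qed.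

Lemma monom_tuple n (t : n.-tuple 'I_N) : monom t = \prod_(i < n) 'X_(tnth t i).
Proof. exact: big_tuple. Qed.

Lemma eq_content s t : (content s == content t) = perm_eq s t.
Proof.
apply/eqP/idP => [/mnmP eqst|/seq.permP eqst]; last first.
  by apply/mnmP => i; rewrite !mnmE eqst.
by apply/allP => i _ /=; have := eqst i; rewrite !mnmE => ->.
Qed.

Lemma perm_monom s t : perm_eq s t -> monom s = monom t.
Proof. by move=> st; rewrite /monom (perm_big _ st). Qed.

Lemma mdeg_content s : mdeg (content s) = size s.
Proof.
rewrite mdegE; elim: s => [|i s IHs]; first by rewrite big1 // => i _; rewrite mnmE.
rewrite /= -IHs (bigD1 i) //= [in RHS](bigD1 i) //= !mnmE /= eqxx.
by congr (_ + _).+1; apply: eq_bigr => j ji; rewrite !mnmE /= eq_sym (negPf ji).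
Qed.

Lemma leq_ord_trans : transitive (fun i j : 'I_N => (i <= j)%N).
Proof. by move=> ? ? ?; apply: leq_trans. Qed.
Lemma leq_ord_total : total (fun i j : 'I_N => (i <= j)%N).
Proof. by move=> ? ?; apply: leq_total. Qed.
Lemma leq_ord_anti : antisymmetric (fun i j : 'I_N => (i <= j)%N).
Proof. by move=> ? ? ?; apply/val_inj/anti_leq. Qed.

Definition word_sort s : seq 'I_N := sort (fun i j : 'I_N => (i <= j)%N) s.

Lemma weakly_increasing_sort s : weakly_increasing (word_sort s).
Proof. exact: sort_sorted leq_ord_total s. Qed.

Lemma perm_word_sort s : perm_eq (word_sort s) s.
Proof. by rewrite perm_sort. Qed.

Lemma weakly_increasing_perm s t :
  weakly_increasing s -> (word_sort t == s) = perm_eq t s.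
Proof.
move=> ws; apply/eqP/idP => [<-|pts]; first by rewrite perm_sym perm_word_sort.
apply: (sorted_eq leq_ord_trans leq_ord_anti) => //; first exact: weakly_increasing_sort.
exact: perm_trans (perm_word_sort t) pts.
Qed.

Lemma content_surj (m : 'X_{1..N}) : exists s, content s = m.
Proof.
exists (flatten [seq nseq (m i) i | i <- enum 'I_N]); apply/mnmP => i.
rewrite mnmE count_flatten -map_comp sumnE big_map big_enum (bigD1 i) //=.
rewrite count_nseq /= eqxx mul1n big1 ?addn0 // => j ji.
by rewrite count_nseq /= (negPf ji).
Qed.

Lemma mcoeff_hsym n m : (hsym F N n%:Z)@_m = (mdeg m == n)%:R.
Proof.
rewrite /hsym linear_sum /=; have [mn|mn] := eqVneq (mdeg m) n.
  have lt_m : (mdeg m < n.+1)%N by rewrite mn.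
  rewrite (bigD1 (BMultinom lt_m)) /= ?mn // mcoeffX eqxx big1 ?addr0 //.
  by move=> a /andP[_ am]; rewrite mcoeffX; case: eqP => // e; by case/eqP: am; apply/val_inj.
rewrite big1 // => a /eqP an; rewrite mcoeffX.
by case: eqP => // am; rewrite -am an eqxx in mn.
Qed.

(** Sorting shows that each exponent vector of degree n is the content of exactly one weakly
    increasing word. *)
Lemma hsymE n : hsym F N n%:Z = \sum_(t : n.-tuple 'I_N | weakly_increasing t) monom t.
Proof.
apply/mpolyP => m; rewrite mcoeff_hsym linear_sum /=.
under eq_bigr do rewrite monomE mcoeffX.
have [mn|mn] := eqVneq (mdeg m) n; last first.
  rewrite big1 // => t _; case: eqP => // tm.
  by rewrite -tm mdeg_content size_tuple eqxx in mn.
have [s sm] := content_surj m; have sz_s : size s = n by rewrite -mn -sm mdeg_content.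
have sz : size (word_sort s) == n by rewrite size_sort sz_s.
rewrite (bigD1 (Tuple sz)) /= ?weakly_increasing_sort // -sm eq_content perm_word_sort.
rewrite big1 ?addr0 // => t /andP[wt ts]; rewrite eq_content perm_sym.
by rewrite -weakly_increasing_perm // eq_sym -val_eqE /= in ts *; rewrite (negPf ts).
Qed.

Lemma hsym0 : hsym F N 0 = 1.
Proof.
rewrite (hsymE 0) (big_pred1 [tuple]) => [|t]; first by rewrite /monom big_nil.
by rewrite (tuple0 t) [RHS]eqxx.
Qed.

Lemma hsym1 : hsym F N 1 = \sum_i 'X_i.
Proof.
rewrite (hsymE 1) (reindex (fun i : 'I_N => [tuple i])) /=.
  by apply: eq_big => [i|i _]; rewrite // /monom big_seq1.
exists (@thead 0 'I_N) => [i _|t _]; first exact: tnth0.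
by rewrite [RHS]tuple_eta; apply: val_inj => /=; case: t => -[|x []].
Qed.

(** The product sums over a letter b and a weakly increasing word t. The pairs with b at most the
    head of t are the weakly increasing words of length n+2; the others are the fillings of a hook
    with a one-cell leg b. *)
Lemma hsymS_sub n :
  hsym F N 1 * hsym F N n.+1%:Z - hsym F N n.+2%:Z =
  \sum_(t : n.+1.-tuple 'I_N | weakly_increasing t)
     \sum_(b : 'I_N | (thead t < b)%N) 'X_b * monom t.
Proof.
apply/eqP; rewrite subr_eq hsym1 (hsymE n.+1) (hsymE n.+2).
rewrite (big_tuple_cons _ n.+1 weakly_increasing monom) /=.
rewrite (exchange_big_dep (fun t : n.+1.-tuple 'I_N => weakly_increasing t)) /=;
  last first.
  by move=> b t _; apply: path_sorted.
rewrite -big_split big_distrr; apply/eqP/eq_bigr => t wt.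
rewrite big_distrl /= (bigID (fun b : 'I_N => (thead t < b)%N)) /=; congr (_ + _).
apply: eq_big => [b|b _]; last by rewrite monom_cons.
rewrite -leqNgt; case/tupleP: t wt => a t wt; rewrite theadE /=.
by rewrite (_ : path _ a t = true) ?andbT.
Qed.

End Words.

(** * Power sums and words constant on cycles *)

Section PowerSums.

Variables (F : fieldType) (N n : nat).
Implicit Types (w : 'S_n) (t : n.-tuple 'I_N).

Definition word_fixed w t := [forall i, tnth t (w i) == tnth t i].

Lemma word_fixed_porbit w t i j :
  word_fixed w t -> j \in porbit w i -> tnth t j = tnth t i.
Proof.
move=> /forallP wt /porbitP[k ->]; elim: k => [|k IHk]; first by rewrite perm1.
by rewrite expgSr permM (eqP (wt _)).
Qed.

(** Expanding the product chooses one letter for each cycle of [w], which amounts to a word constant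
    on the cycles; a cycle c contributes its letter with exponent [#|c|]. *)
Lemma prod_psum w : (0 < N)%N ->
  \prod_(c in porbits w) psum F N #|c| = \sum_(t | word_fixed w t) monom F t.
Proof.
move=> N_gt0; pose j0 := Ordinal N_gt0.
rewrite (big_distr_big j0) /=.
pose rep (c : {set 'I_n}) := [pick i in c].
(* The expanded product is indexed by functions on all sets of positions with the default [j0] off
   the cycles; [h] and [h'] translate between these and words. *)
pose h t := [ffun c : {set 'I_n} =>
  if c \in porbits w then oapp (tnth t) j0 (rep c) else j0].
pose h' (f : {ffun {set 'I_n} -> 'I_N}) := [tuple f (porbit w i) | i < n].
have in_porbits i : porbit w i \in porbits w by apply: imset_f.
have repP c : c \in porbits w -> exists2 i, rep c = Some i & c = porbit w i.
  case/imsetP=> i _ ->; rewrite /rep; case: pickP => [j ji|/(_ i)]; last first.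
    by rewrite porbit_id.
  by exists j => //; apply/esym/eqP; rewrite eq_porbit_mem.
rewrite (reindex_onto h h') /= => [|f /pffun_onP[/supportP f0 _]]; last first.
  apply/ffunP => c; rewrite ffunE; case: ifPn => [cw|/f0->//].
  by have [i -> ->] := repP c cw; rewrite /= tnth_mktuple.
have hE t i : h t (porbit w i) = tnth (h' (h t)) i.
  by rewrite [RHS]tnth_mktuple.
apply: eq_big => [t|t /andP[_ /eqP ht]].
  apply/andP/idP => [[_ /eqP ht]|wt].
    apply/forallP => i; rewrite -ht -!hE.
    by have := porbit_perm w 1 i; rewrite expg1 => ->.
  split; last first.
    apply/eqP/eq_from_tnth => i; rewrite -hE ffunE in_porbits.
    have [k rk kE] := repP _ (in_porbits i).
    by rewrite rk /=; apply: word_fixed_porbit wt _; rewrite porbit_sym -eq_porbit_mem kE.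
  apply/pffun_onP; split; last by [].
  by apply/supportP => c /negPf cw; rewrite ffunE cw.
rewrite monom_tuple (partition_big (porbit w) (mem (porbits w)) (fun i _ => in_porbits i)) //=.
apply: eq_bigr => c cw; rewrite (eq_bigr (fun=> 'X_(h t c))) => [|i /eqP <-].
  rewrite prodr_const; congr (_ ^+ _).
  have [i _ ->] := repP c cw; apply: eq_card => j; rewrite unfold_in /=.
  by rewrite [RHS]eq_porbit_mem.
by rewrite hE ht.
Qed.

Lemma frobE (a : {ffun 'S_n -> F}) : (0 < N)%N ->
  frob N a = (n`!%:R)^-1 *: \sum_w \sum_(t | word_fixed w t) a w *: monom F t.
Proof.
move=> N_gt0; rewrite /frob; congr (_ *: _); apply: eq_bigr => w _.
by rewrite prod_psum // scaler_sumr.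
Qed.

End PowerSums.

Section Conjugation.

Variables (N n : nat).
Implicit Types (w s : 'S_n) (t : n.-tuple 'I_N).

Definition word_perm t s : n.-tuple 'I_N := [tuple tnth t (s i) | i < n].

Lemma word_permP t u : reflect (exists s, u = word_perm t s) (perm_eq u t).
Proof.
apply: (iffP tuple_permP) => -[s us]; exists s; first exact: val_inj.
by rewrite us.
Qed.

Lemma word_fixedE w t : word_fixed w t = (word_perm t w == t).
Proof.
apply/forallP/eqP => [wt|wt i]; last first.
  by rewrite -[X in _ == tnth X _]wt tnth_mktuple.
by apply: eq_from_tnth => i; rewrite tnth_mktuple (eqP (wt i)).
Qed.

Lemma word_permM t s w : word_perm t (s * w)%g = word_perm (word_perm t w) s.
Proof. by apply: eq_from_tnth => i; rewrite !tnth_mktuple permM. Qed.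

Lemma word_perm_inj s : injective (word_perm^~ s).
Proof.
move=> t u tu; apply: eq_from_tnth => i.
by have /(congr1 (fun v => tnth v (s^-1%g i))) := tu; rewrite !tnth_mktuple permKV.
Qed.

Lemma word_fixed_perm w t s : word_fixed w (word_perm t s) = word_fixed (w ^ s)%g t.
Proof.
rewrite !word_fixedE -[LHS](inj_eq (@word_perm_inj s^-1)) -!word_permM mulVg.
congr (_ == _); first by rewrite conjgE ?mulgA.
by apply: eq_from_tnth => i; rewrite tnth_mktuple perm1.
Qed.

(* Each w is counted once, through the word t o w. *)
Lemma sum_word_stab t :
  (\sum_(u : n.-tuple 'I_N | perm_eq u t) \sum_w (word_fixed w u : nat) = n`!)%N.
Proof.
transitivity (\sum_(u : n.-tuple 'I_N | perm_eq u t) \sum_w (word_perm t w == u : nat))%N.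
  apply: eq_bigr => u /word_permP[s ->].
  rewrite [RHS](reindex_inj (h := fun w => (w * s)%g)) /=; last exact: mulIg.
  by apply: eq_bigr => w _; rewrite word_permM word_fixedE.
rewrite exchange_big /= -card_Sn -sum1_card; apply: eq_big => // w _.
have pt : perm_eq (word_perm t w) t by apply/word_permP; exists w.
rewrite (bigD1 _ pt) /= eqxx.
by rewrite big1 // => u /andP[_ /negPf]; rewrite eq_sym => ->.
Qed.

End Conjugation.

Section FrobeniusCharacteristic.

Variables (F : fieldType) (N : nat).
Hypotheses (pchar0 : [pchar F] =i pred0) (N_gt0 : (0 < N)%N).

Let nat_neq0 n : (0 < n)%N -> n%:R != 0 :> F.
Proof. by move=> n0; rewrite (proj1 (pcharf0P F) pchar0) -lt0n. Qed.

(** Words are grouped by their sorted rearrangement; by [sum_word_stab] each group contributes its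
    monomial n! times, which cancels the leading factor. *)
Lemma frob1 n : frob N [ffun _ : 'S_n => 1 : F] = hsym F N n.
Proof.
rewrite frobE // hsymE.
under eq_bigr do under eq_bigr do rewrite ffunE scale1r.
rewrite (exchange_big_dep xpredT) //=.
have sz (t : n.-tuple 'I_N) : size (word_sort t) == n by rewrite size_sort size_tuple.
rewrite (partition_big (fun t : n.-tuple 'I_N => Tuple (sz t)) (fun t => weakly_increasing t))
  => [|t _]; last exact: weakly_increasing_sort.
rewrite scaler_sumr; apply: eq_bigr => t wt.
under eq_bigl do rewrite -val_eqE /= weakly_increasing_perm //.
rewrite (eq_bigr (fun u => monom F t *+ (\sum_(w : 'S_n) word_fixed w u)%N)); last first.
  by move=> u ut; rewrite sumr_const -sum1_card big_mkcond /= (perm_monom _ ut).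
rewrite sumrMnr sum_word_stab -scaler_nat scalerA mulVf ?scale1r //.
exact: nat_neq0 (fact_gt0 n).
Qed.

End FrobeniusCharacteristic.

(** * Permutations with the same cycles *)

Lemma iter_perm_mod (T : finType) (w : {perm T}) x k :
  iter k w x = iter (k %% #|porbit w x|) w x.
Proof.
rewrite [in LHS](divn_eq k #|porbit w x|) addnC iterD; congr iter.
by elim: (k %/ _)%N => //= q IHq; rewrite mulSn iterD IHq iter_porbit.
Qed.

Lemma eq_iter_perm (T : finType) (w : {perm T}) x k l :
  (iter k w x == iter l w x) = (k == l %[mod #|porbit w x|]).
Proof.
rewrite iter_perm_mod [X in _ == X]iter_perm_mod.
have m_gt0 : (0 < #|porbit w x|)%N by rewrite lt0n card_porbit_neq0.
have := nth_uniq x _ _ (uniq_traject_porbit w x); rewrite size_traject.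
move=> /(_ (k %% #|porbit w x|) (l %% #|porbit w x|))%N.
by rewrite !ltn_pmod // !nth_traject ?ltn_pmod // => ->.
Qed.

(** The conjugating permutation sends the k-th iterate of [w0] at the base point of a cycle to the
    k-th iterate of [w] at that point; this is consistent because the two cycles have the same
    length. *)
Lemma conj_of_eq_porbit (T : finType) (w0 w : {perm T}) :
  porbit w =1 porbit w0 -> exists s, w = (w0 ^ s)%g.
Proof.
move=> eqw; pose r x := odflt x [pick y in porbit w0 x].
have rP x : x \in porbit w0 (r x).
  rewrite /r; case: pickP => [y|/(_ x)]; first by rewrite porbit_sym.
  by rewrite porbit_id.
have r_eq x y : porbit w0 x = porbit w0 y -> r x = r y.
  by rewrite /r => ->; case: pickP => // /(_ y); rewrite porbit_id.
have [k kP] : exists k : T -> nat, forall x, x = iter (k x) w0 (r x).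
  have exk x : exists k, x == iter k w0 (r x).
    by have /porbitP[k xk] := rP x; exists k; rewrite -permX -xk.
  by exists (fun x => xchoose (exk x)) => x; apply/eqP/(xchooseP (exk x)).
pose f x := iter (k x) w (r x).
have fE x l : x = iter l w0 (r x) -> f x = iter l w (r x).
  by move=> xl; apply/eqP; rewrite eq_iter_perm eqw -eq_iter_perm -xl -kP.
have f_porbit x : porbit w0 (f x) = porbit w0 x.
  rewrite -eqw /f -permX porbit_perm eqw; apply/eqP.
  by rewrite eq_porbit_mem porbit_sym.
have f_inj : injective f.
  move=> x y fxy; have rxy : r x = r y by apply: r_eq; rewrite -f_porbit fxy f_porbit.
  rewrite (kP x) (kP y) -rxy.
  apply/eqP; rewrite eq_iter_perm -eqw -eq_iter_perm; apply/eqP.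
  by rewrite -/(f x) fxy /f rxy.
exists (perm f_inj); apply: (mulgI (perm f_inj)); rewrite -conjgC.
apply/permP => x; rewrite !permM !permE.
have rw : r (w0 x) = r x by apply: r_eq; have := porbit_perm w0 1 x; rewrite expg1.
by rewrite (fE (w0 x) (k x).+1) rw //= -kP.
Qed.

(** * Injectivity of the characteristic and internal products *)

Section FrobeniusInjective.

Variables (F : fieldType) (N n : nat).
Hypotheses (pchar0 : [pchar F] =i pred0) (N_gt0 : (0 < N)%N) (le_nN : (n <= N)%N).
Implicit Types a b : {ffun 'S_n -> F}.

(** The words contributing to this monomial are the rearrangements of [t]; conjugation carries the
    stabiliser of one to that of another, so a class function has the same sum over each. *)
Lemma mcoeff_frob a (t : n.-tuple 'I_N) : class_function a ->
  (n`!%:R * (frob N a)@_(content t) =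
   (\sum_(w | word_fixed w t) a w) *+ #|[pred u : n.-tuple 'I_N | perm_eq u t]|)%R.
Proof.
move=> cla; rewrite frobE // mcoeffZ mulrA divff ?mul1r; last first.
  by rewrite (proj1 (pcharf0P F) pchar0) -lt0n fact_gt0.
rewrite (exchange_big_dep xpredT) //= linear_sum /= -sumr_const.
rewrite (bigID (fun u : n.-tuple 'I_N => perm_eq u t)) /= addrC big1 ?add0r => [|u ut].
  apply: eq_bigr => u ut; rewrite linear_sum /=.
  rewrite (eq_bigr a) => [|w _]; last first.
    by rewrite mcoeffZ monomE mcoeffX eq_content ut mulr1.
  have /word_permP[s ->] := ut.
  rewrite [RHS](reindex_inj (conjg_inj s)) /=.
  by apply: eq_big => [w|w _]; rewrite ?word_fixed_perm ?cla.
rewrite linear_sum big1 //= => w _.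
by rewrite mcoeffZ monomE mcoeffX eq_content (negPf ut) mulr0.
Qed.

(* A permutation fixing the word i |-> index of the w0-cycle of i has cycles
   contained in those of w0; if w0 has the most cycles among the permutations in
   the support of a, then on this support the cycles must be equal. *)
Lemma frob_eq0 a : class_function a -> frob N a = 0 -> a = 0.
Proof.
move=> cla fa0; apply/ffunP => v; rewrite ffunE; apply: contraTeq isT => av.
case: (@arg_maxnP _ v (fun w => a w != 0) (fun w => #|porbits w|) av) => w0 aw0 maxw0.
have in_porbits w i : porbit w i \in porbits w by apply: imset_f.
have idx_lt i : (index (porbit w0 i) (enum (porbits w0)) < N)%N.
  have : (#|porbits w0| <= N)%N.
    apply: leq_trans le_nN; rewrite -[X in (_ <= X)%N]card_ord.
    exact: leq_imset_card.
  by apply: leq_trans; rewrite cardE index_mem mem_enum in_porbits.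
pose t0 : n.-tuple 'I_N := [tuple Ordinal (idx_lt i) | i < n].
have t0E i j : (tnth t0 i == tnth t0 j) = (porbit w0 i == porbit w0 j).
  rewrite !tnth_mktuple -val_eqE /=; apply/eqP/eqP => [|->//].
  by apply: (index_inj set0 (s := enum (porbits w0))); rewrite mem_enum in_porbits.
have aE w : word_fixed w t0 -> a w != 0 -> a w = a w0.
  move=> wt aw; have sub i j : porbit w i = porbit w j -> porbit w0 i = porbit w0 j.
    move=> /eqP; rewrite eq_porbit_mem => ij; apply/eqP; rewrite -t0E.
    by rewrite (word_fixed_porbit wt ij).
  (* [psi] sends a cycle of [w] to the cycle of [w0] containing it. It is onto, and [w] has at most
     as many cycles as [w0], so it is injective and the cycles agree. *)
  pose psi (c : {set 'I_n}) := oapp (porbit w0) set0 [pick i in c].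
  have psiE i : psi (porbit w i) = porbit w0 i.
    rewrite /psi; case: pickP => [j|/(_ i)] /=; last by rewrite porbit_id.
    by rewrite -eq_porbit_mem => /eqP/sub.
  have psi_im : psi @: porbits w = porbits w0.
    by rewrite -imset_comp; apply: eq_imset => i; apply: psiE.
  have /imset_injP psi_inj : #|psi @: porbits w| == #|porbits w|.
    by rewrite eqn_leq leq_imset_card psi_im; apply: maxw0.
  have [i|s ->] := @conj_of_eq_porbit _ w0 w; last exact: cla.
  apply/setP => j; rewrite -!eq_porbit_mem; apply/eqP/eqP => [/sub//|].
  by move=> ij; apply: psi_inj; rewrite ?in_porbits // !psiE ij.
have w0t0 : word_fixed w0 t0.
  by apply/forallP => i; rewrite t0E; have := porbit_perm w0 1 i; rewrite expg1 => ->.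
(* Up to the factor n!, the coefficient attached to [t0] is a positive multiple of [a w0], hence
   nonzero in characteristic 0. *)
have := mcoeff_frob t0 cla; rewrite fa0 mcoeff0 mulr0.
rewrite (bigID (fun w => a w != 0)) /= [X in _ + X]big1 => [|w]; last first.
  by case/andP=> _ /negPn/eqP.
rewrite addr0 (eq_bigr (fun=> a w0)) => [|w /andP[]]; last exact: aE.
rewrite sumr_const -mulrnA -mulr_natr => /esym/eqP; rewrite mulf_eq0 (negPf aw0) /=.
rewrite (proj1 (pcharf0P F) pchar0) muln_eq0.
case/orP=> /eqP/card0_eq; first by move/(_ w0); rewrite unfold_in /= w0t0 aw0.
by move/(_ t0); rewrite !inE perm_refl.
Qed.

Lemma frobB a b : frob N (a - b) = frob N a - frob N b.
Proof.
rewrite /frob -scalerBr -sumrB; congr (_ *: _); apply: eq_bigr => w _.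
by rewrite !ffunE scalerBl.
Qed.

Lemma frob_inv_frob a : class_function a -> frob_inv n (frob N a) = a.
Proof.
move=> cla; apply: classical_sets.xget_unique => [//|b [clb fb]].
apply/eqP; rewrite -subr_eq0; apply/eqP/frob_eq0; last by rewrite frobB fb subrr.
by move=> s t; rewrite !ffunE cla clb.
Qed.

Lemma kron_frob a b : class_function a -> class_function b ->
  kron n (frob N a) (frob N b) = frob N [ffun w => a w * b w].
Proof. by move=> cla clb; rewrite /kron !frob_inv_frob. Qed.

Lemma kron_pow_frob a m : class_function a ->
  kron_pow n (frob N a) m = frob N [ffun w => a w ^+ m].
Proof.
move=> cla; rewrite /kron_pow; case: m => [|m].
  rewrite -[LHS]/(hsym F N n%:Z) -(frob1 pchar0 N_gt0).
  by congr frob; apply/ffunP => w; rewrite !ffunE.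
rewrite iteropS; elim: m => [|m IHm].
  by congr frob; apply/ffunP => w; rewrite ffunE expr1.
rewrite iterS IHm kron_frob //; last by move=> s t; rewrite !ffunE cla.
by congr frob; apply/ffunP => w; rewrite !ffunE -exprS.
Qed.

End FrobeniusInjective.

(** * Falling factorials of the number of fixed points *)

Section FallingFactorial.

Variables (F : fieldType) (N : nat).
Hypotheses (pchar0 : [pchar F] =i pred0) (N_gt0 : (0 < N)%N).

Definition fixpoints n (w : 'S_n) := #|[set i | w i == i]|.

Lemma fixpoints_class n (w s : 'S_n) : fixpoints (w ^ s)%g = fixpoints w.
Proof.
rewrite /fixpoints -[RHS](card_imset _ (@perm_inj _ s)); apply: eq_card => i.
apply/idP/imsetP => [|[j]]; rewrite !inE; last first.
  by move=> /eqP wj ->; rewrite -permM -conjgC permM wj.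
move=> /eqP wi; exists (s^-1%g i); rewrite ?permKV // inE.
by rewrite -(inj_eq (@perm_inj _ s)) permKV -{2}wi conjgE !permM.
Qed.

(** Lifting is injective, and the permutations fixing [i] are as many as the permutations of n
    letters, so all of them are lifts. *)
Lemma big_perm_fixing (R : Type) (idx : R) (op : Monoid.com_law idx) n i
    (G : 'S_n.+1 -> R) :
  \big[op/idx]_(w : 'S_n.+1 | w i == i) G w =
  \big[op/idx]_(s : 'S_n) G (lift_perm i i s).
Proof.
have lift_inj : injective (@lift_perm n i i).
  move=> s t /permP eqst; apply/permP => k; apply: (@lift_inj _ i).
  by rewrite -!(lift_perm_lift i i) eqst.
rewrite -[RHS](big_imset (h := lift_perm i i) _ (in2W lift_inj)) /=.
apply: eq_bigl => w; apply/eqP/imsetP => [wi|[s _ ->]]; last by rewrite lift_perm_id.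
suff : w \in [set lift_perm i i s | s in [set: 'S_n]].
  by case/imsetP=> s _ ->; exists s.
have card_lift : #|[set lift_perm i i s | s in [set: 'S_n]]| = #|perm_on [set~ i]|.
  by rewrite card_imset // cardsT card_Sn card_perm cardsC1 card_ord.
rewrite (subset_cardP card_lift _).
  rewrite unfold_in /perm_on; apply/subsetP => k; rewrite !inE.
  by apply: contraNneq => ->; rewrite wi.
apply/subsetP => _ /imsetP[s _ ->]; apply/subsetP => k; rewrite !inE.
by apply: contraNneq => ->; rewrite lift_perm_id.
Qed.

Lemma fixpoints_lift n i (s : 'S_n) : fixpoints (lift_perm i i s) = (fixpoints s).+1.
Proof.
rewrite /fixpoints -!sum1_card !big_mkcond /= (bigD1_ord i) //=.
rewrite inE lift_perm_id eqxx add1n; congr _.+1.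
rewrite [RHS]big_mkcond; apply: eq_bigr => k _.
by rewrite !inE lift_perm_lift (inj_eq lift_inj).
Qed.

(** The letter at the fixed position [i] is unconstrained, which gives the factor [hsym F N 1]. *)
Lemma sum_word_fixed_lift n i (s : 'S_n) :
  \sum_(t : n.+1.-tuple 'I_N | word_fixed (lift_perm i i s) t) monom F t =
  hsym F N 1 * \sum_(t : n.-tuple 'I_N | word_fixed s t) monom F t.
Proof.
rewrite hsym1 big_distrl /=; under [RHS]eq_bigr do rewrite big_distrr /=.
pose h (p : 'I_N * n.-tuple 'I_N) : n.+1.-tuple 'I_N :=
  [tuple if unlift i k is Some l then tnth p.2 l else p.1 | k < n.+1].
have hi p : tnth (h p) i = p.1 by rewrite tnth_mktuple unlift_none.
have hl p k : tnth (h p) (lift i k) = tnth p.2 k by rewrite tnth_mktuple liftK.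
rewrite pair_big_dep /= (reindex h) /=; last first.
  exists (fun t => (tnth t i, [tuple tnth t (lift i k) | k < n])) => [[b t] _|t _].
    by congr pair; [rewrite hi|apply: eq_from_tnth => k; rewrite tnth_mktuple hl].
  apply: eq_from_tnth => k; case: (unliftP i k) => [l|] ->; first by rewrite hl tnth_mktuple.
  by rewrite hi.
apply: eq_big => [p|p _].
  apply/forallP/forallP => [wt k|wt k].
    by have := wt (lift i k); rewrite lift_perm_lift !hl.
  by case: (unliftP i k) => [l|] ->; rewrite ?lift_perm_lift ?hl ?lift_perm_id.
rewrite -[LHS]/(monom F (h p)) !monom_tuple (bigD1_ord i) //= hi; congr (_ * _).
by apply: eq_bigr => k _; rewrite hl.
Qed.

(** Induction on d: the falling factorial of f of order d+1 is f times that of f - 1 of order d, and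
    the factor f is a choice of a fixed point. Removing this point splits off one [hsym F N 1]. *)
Lemma frob_ffact n d :
  frob N [ffun w : 'S_n => (fixpoints w ^_ d)%:R : F] =
  hsym F N 1 ^+ d * hsym F N (n%:Z - d%:Z).
Proof.
elim: d n => [|d IHd] [|n].
- by rewrite -(frob1 pchar0 N_gt0); rewrite mul1r subr0 -(frob1 pchar0 N_gt0);
    congr frob; apply/ffunP => w; rewrite !ffunE.
- by rewrite mul1r subr0 -(frob1 pchar0 N_gt0);
    congr frob; apply/ffunP => w; rewrite !ffunE.
(* With no letters left there is no fixed point, and [hsym] is 0 at a negative integer. *)
- rewrite sub0r /= mulr0 /frob big1 ?scaler0 // => w _.
  rewrite ffunE (_ : fixpoints w = 0%N) ?scale0r //.
  by apply: eq_card0 => -[].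
have -> : n.+1%:Z - d.+1%:Z = n%:Z - d%:Z by rewrite !intS opprD addrACA subrr add0r.
rewrite exprS -mulrA -IHd !frobE // -scalerAr.
rewrite (eq_bigr (fun w : 'S_n.+1 => \sum_(i | w i == i)
   ((fixpoints w).-1 ^_ d)%:R *: \sum_(t : n.+1.-tuple 'I_N | word_fixed w t) monom F t)).
  rewrite (exchange_big_dep xpredT) //=.
  under eq_bigr do rewrite big_perm_fixing.
  under eq_bigr do under eq_bigr do rewrite fixpoints_lift sum_word_fixed_lift /=.
  (* The n+1 choices of the fixed point turn 1/(n+1)! into 1/n!. *)
  rewrite sumr_const card_ord -scaler_nat scalerA factS natrM.
  rewrite invfM mulrAC mulVf ?mul1r ?(proj1 (pcharf0P F) pchar0) // mulr_sumr.
  congr (_ *: _); apply: eq_bigr => s _.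
  by rewrite -scaler_sumr -scalerAr ffunE.
move=> w _; rewrite sumr_const ffunE ffactnS natrM mulr_natl -scaler_sumr.
rewrite -scalerMnl; congr (_ *: _ *+ _).
by apply: eq_card => i; rewrite inE.
Qed.

Lemma frob_fix n : frob N [ffun w : 'S_n => (fixpoints w)%:R : F] =
  hsym F N 1 * hsym F N (n%:Z - 1).
Proof.
rewrite -[X in X * _]expr1 -frob_ffact; congr frob; apply/ffunP => w.
by rewrite !ffunE ffactn1.
Qed.

End FallingFactorial.

(** * The Schur function of the shape (m+1, 1) *)

Section HookSchur.

Variables (F : fieldType) (N m : nat).
Notation hook := [:: m.+1; 1%N].

Definition arm_cell (i : 'I_m.+1) : cell hook :=
  Sub (ord0, widen_ord (leq_addr (1 + 0) m.+1) i) (ltn_ord i).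
Definition leg_cell : cell hook := Sub (ord_max, ord0) isT.

Lemma hook_cellP (c : cell hook) : c = leg_cell \/ exists i, c = arm_cell i.
Proof.
case: c => -[[[|[|//]] r_lt] [c c_lt]] /= c_lt'; [right|left].
  by exists (Ordinal c_lt'); apply: val_inj; congr pair; apply: val_inj.
by apply: val_inj; congr pair; apply: val_inj => //=; case: c c_lt c_lt'.
Qed.

Lemma arm_cell_inj : injective arm_cell.
Proof. by move=> i j /(congr1 (fun c : cell hook => (val c).2 : nat)) /= /val_inj. Qed.

Lemma arm_neq_leg i : (arm_cell i == leg_cell) = false.
Proof. by apply/eqP => /(congr1 (fun c : cell hook => (val c).1 : nat)). Qed.

Lemma big_hook_cell (R : Type) (idx : R) (op : Monoid.com_law idx) (G : cell hook -> R) :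
  \big[op/idx]_c G c = op (G leg_cell) (\big[op/idx]_(i < m.+1) G (arm_cell i)).
Proof.
rewrite (bigD1 leg_cell) //=; congr (op _ _).
rewrite -(big_imset (h := arm_cell) (A := xpredT) G) /=; last exact: in2W arm_cell_inj.
apply: eq_bigl => c; case: (hook_cellP c) => [-> | [i ->]].
  by rewrite eqxx; apply/esym/imsetP => -[i _ /esym/eqP]; rewrite arm_neq_leg.
by rewrite arm_neq_leg imset_f.
Qed.

Lemma semistandard_hook (T : {ffun cell hook -> 'I_N}) :
  semistandard T = weakly_increasing [tuple T (arm_cell i) | i < m.+1]
                   && (T (arm_cell ord0) < T leg_cell)%N.
Proof.
set t := mktuple _; pose x0 := T leg_cell.
have tE (i : 'I_m.+1) : T (arm_cell i) = nth x0 t i.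
  by rewrite -tnth_nth tnth_mktuple.
apply/forallP/andP => [sT|[wt lt0] c]; last first.
  apply/forallP => d.
have arm_le (i j : 'I_m.+1) : (i <= j)%N -> (T (arm_cell i) <= T (arm_cell j))%N.
  move=> ij; rewrite !tE.
  by apply: (sorted_leq_nth (@leq_ord_trans N)) => //; rewrite inE size_tuple.
case: (hook_cellP c) => [-> | [i ->]]; case: (hook_cellP d) => [-> | [j ->]].
- by rewrite /= ?leqnn ?ltnn ?implybT.
- by rewrite /= andbF.
- rewrite /= andbT; apply/implyP=> /eqP; case: i => -[|i] //= im _.
  by rewrite (_ : Ordinal im = ord0) //; apply: val_inj.
- by rewrite /= ?andbT ?andbF ?andbT; apply/implyP => ij; apply: arm_le.
have {}sT c d := forallP (sT c) d; split; last first.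
  by have /andP[_] := sT (arm_cell ord0) leg_cell.
apply/(sortedP x0) => i; rewrite size_tuple => im.
have /andP[+ _] := sT (arm_cell (Ordinal (ltnW im))) (arm_cell (Ordinal im)).
by rewrite !tE /= leqnSn.
Qed.

(** The Jacobi-Trudi identity for this shape: its semistandard fillings are the pairs summed over in
    [hsymS_sub], since only the first column has two cells. *)
Lemma schur_hook :
  schur F N hook = hsym F N 1 * hsym F N m.+1%:Z - hsym F N m.+2%:Z.
Proof.
rewrite hsymS_sub pair_big_dep /=.
pose h (T : {ffun cell hook -> 'I_N}) := ([tuple T (arm_cell i) | i < m.+1], T leg_cell).
pose h' (p : m.+1.-tuple 'I_N * 'I_N) := [ffun c : cell hook =>
  if c == leg_cell then p.2 else tnth p.1 (inord (val c).2)].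
have hK : cancel h h'.
  move=> T; apply/ffunP => c; rewrite ffunE; case: (hook_cellP c) => [-> | [i ->]].
    by rewrite eqxx.
  by rewrite arm_neq_leg tnth_mktuple /= inord_val.
have h'K : cancel h' h.
  move=> [t b]; congr pair; last by rewrite ffunE eqxx.
  by apply: eq_from_tnth => i; rewrite tnth_mktuple ffunE arm_neq_leg /= inord_val.
rewrite [RHS](reindex h) /=; last by exists h'; [move=> T _|move=> p _].
apply: eq_big => [T|T _]; first by rewrite semistandard_hook [thead _]tnth_mktuple.
rewrite big_hook_cell; congr (_ * _).
by rewrite -[RHS]/(monom F (h T).1) monom_tuple; apply: eq_bigr => i _; rewrite tnth_mktuple.
Qed.

End HookSchur.

(** At x = 0 the falling factorial expansion is a vanishing sum of natural numbers, whose term d = 0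
    is this coefficient. *)
Lemma stirling2_0 m : stirling2 m.+1 0 = 0%N.
Proof.
have := expn_stirling2 m.+1 0; rewrite big_ord_recl /= ffactn0 muln1 exp0n //.
by move/esym/eqP; rewrite addn_eq0 => /andP[/eqP].
Qed.

Lemma stirling2_star_0 m : stirling2_star m.+1 0 = 0%N.
Proof.
have := smirnov_stirling2_star m 0; rewrite big_ord_recl /= ffactn0 muln1 mul0n.
by move/esym/eqP; rewrite addn_eq0 => /andP[/eqP].
Qed.

Lemma stirling2_star_1 m : stirling2_star m.+2 1 = 0%N.
Proof.
have := smirnov_stirling2_star m.+1 1; rewrite 2!big_ord_recl /= ffactn1 muln1 exp0n //.
rewrite stirling2_star_0 mul0n muln0 /bump /= => /esym/eqP.
by rewrite !addn_eq0 => /and3P[_ /eqP].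
Qed.

(** * Expansions in the products of h_1 and h_(n-d) *)

Section HookSums.

Variables (F : fieldType) (N : nat).
Hypotheses (pchar0 : [pchar F] =i pred0) (N_gt0 : (0 < N)%N).
Notation h := (hsym F N).

(** The character of Smirnov words of length m+1. The truncated predecessor is harmless, as the
    first factor is 0 when no letter is fixed. *)
Definition smirnov_character n m : {ffun 'S_n -> F} :=
  [ffun w => (fixpoints w * (fixpoints w).-1 ^ m)%:R].

(** By linearity of [frob] and [frob_ffact], an expansion of [g] in falling factorials becomes one
    in products of complete functions. *)
Lemma frob_stirling n m (c : nat -> nat -> nat) (g : nat -> nat) r :
    (forall x, g x = \sum_(d < r) c m d * x ^_ d)%N ->
  frob N [ffun w : 'S_n => (g (fixpoints w))%:R : F] =
  \sum_(d < r) (c m d)%:R *: (h 1 ^+ d * h (n%:Z - d%:Z)).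
Proof.
move=> gE; under eq_bigr do rewrite -frob_ffact //.
rewrite /frob; under [RHS]eq_bigr do rewrite scalerA mulrC -scalerA.
rewrite -scaler_sumr; congr (_ *: _).
under [RHS]eq_bigr do rewrite scaler_sumr.
rewrite exchange_big; apply: eq_bigr => w _ /=.
rewrite ffunE gE natr_sum scaler_suml; apply: eq_bigr => d _.
by rewrite ffunE natrM scalerA.
Qed.

Lemma frob_expn n m :
  frob N [ffun w : 'S_n => (fixpoints w)%:R ^+ m : F] =
  \sum_(d < m.+1) (stirling2 m d)%:R *: (h 1 ^+ d * h (n%:Z - d%:Z)).
Proof.
rewrite -(frob_stirling _ (expn_stirling2 m)); congr frob; apply/ffunP => w.
by rewrite !ffunE natrX.
Qed.

Lemma frob_smirnov_star n m :
  frob N (smirnov_character n m) =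
  \sum_(d < m.+2) (stirling2_star m.+1 d)%:R *: (h 1 ^+ d * h (n%:Z - d%:Z)).
Proof. by rewrite -(frob_stirling _ (smirnov_stirling2_star m)). Qed.

(** The power of f - 1 is expanded in falling factorials of f - 1; multiplication by f raises the
    order of each by one. *)
Lemma frob_smirnov n m :
  frob N (smirnov_character n m) =
  \sum_(d < m.+1) (stirling2 m d)%:R *: (h 1 ^+ d.+1 * h (n%:Z - d.+1%:Z)).
Proof.
pose c m d := if d is e.+1 then stirling2 m e else 0%N.
rewrite (@frob_stirling n m c (fun x => x * x.-1 ^ m)%N m.+2) => [|x].
  by rewrite big_ord_recl /= scale0r add0r.
rewrite big_ord_recl /= mul0n add0n expn_stirling2 big_distrr /=.
by apply: eq_bigr => d _; rewrite mulnCA ffactnS.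
Qed.

Lemma hook_sumE n m :
  \sum_(2 <= d < m.+3) (stirling2 m.+1 d.-1)%:R *: (h 1 ^+ d * h (n%:Z - d%:Z)) =
  frob N (smirnov_character n m.+1).
Proof.
rewrite frob_smirnov big_ord_recl stirling2_0 scale0r add0r big_add1 big_add1.
by rewrite big_mkord; apply: eq_bigr.
Qed.

Lemma hook_sum_starE n m :
  \sum_(2 <= d < m.+3) (stirling2_star m.+2 d)%:R *: (h 1 ^+ d * h (n%:Z - d%:Z)) =
  frob N (smirnov_character n m.+1).
Proof.
rewrite frob_smirnov_star 2!big_ord_recl stirling2_star_0 scale0r add0r.
rewrite [lift ord0 ord0 : nat]/= stirling2_star_1 scale0r add0r.
by rewrite 2!big_add1 big_mkord; apply: eq_bigr.
Qed.

(** h_1 h_n and s_(n,1) are the characteristics of f and f - 1, and the internal product multiplies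
    characters pointwise. *)
Lemma kron_smirnov n m : (0 < n)%N -> (n < N)%N ->
  kron n.+1 (h 1 * h (n.+1%:Z - 1)) (kron_pow n.+1 (schur F N [:: n; 1%N]) m) =
  frob N (smirnov_character n.+1 m).
Proof.
case: n => // n _ ltnN; have fixc : class_function [ffun w : 'S_n.+2 => (fixpoints w)%:R : F].
  by move=> w s; rewrite !ffunE fixpoints_class.
have refl : class_function [ffun w : 'S_n.+2 => (fixpoints w)%:R - 1 : F].
  by move=> w s; rewrite !ffunE fixpoints_class.
have -> : schur F N [:: n.+1; 1%N] = frob N [ffun w : 'S_n.+2 => (fixpoints w)%:R - 1 : F].
  rewrite schur_hook -(frob1 pchar0 N_gt0 n.+2).
  have -> : n.+1%:Z = n.+2%:Z - 1 by rewrite [n.+2%:Z]intS addrC addKr.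
  rewrite -frob_fix // -frobB; congr frob; apply/ffunP => w.
  by rewrite !ffunE.
rewrite kron_pow_frob // -frob_fix // kron_frob //; last first.
  by move=> w s; rewrite !ffunE fixpoints_class.
congr frob; apply/ffunP => w; rewrite !ffunE natrM natrX.
(* Without fixed letters f - 1 differs from the truncated predecessor, but the factor f kills both
   sides. *)
by case: (fixpoints w) => [|x]; rewrite ?mul0r //= -natr1 addrK.
Qed.

(** The internal power in degree n is the characteristic of f^m, expanded with S(m, d); the factor
    h_1 raises each exponent by one, which gives [frob_smirnov] in degree n+1. *)
Lemma hsym1_kron_pow n m : (n < N)%N ->
  h 1 * kron_pow n (h 1 * h (n%:Z - 1)) m = frob N (smirnov_character n.+1 m).
Proof.
move=> ltnN; rewrite -frob_fix // kron_pow_frob //; last 2 first.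
- exact: ltnW.
- by move=> w s; rewrite !ffunE fixpoints_class.
transitivity (h 1 * frob N [ffun w : 'S_n => (fixpoints w)%:R ^+ m : F]).
  by congr (_ * frob _ _); apply/ffunP => w; rewrite !ffunE.
rewrite frob_expn frob_smirnov mulr_sumr; apply: eq_bigr => d _.
by rewrite -scalerAr mulrA exprS !intS opprD addrACA subrr add0r.
Qed.

Lemma h_positive0 n : h_positive n (0 : {mpoly F[N]}).
Proof. by exists [::]; rewrite big_nil. Qed.

Lemma h_positiveD n (f g : {mpoly F[N]}) :
  h_positive n f -> h_positive n g -> h_positive n (f + g).
Proof.
by move=> [s [ps ->]] [t [pt ->]]; exists (s ++ t); rewrite all_cat ps big_cat.
Qed.

Lemma h_positive_hook n c d :
  h_positive n (c%:R *: (h 1 ^+ d * h (n%:Z - d%:Z))).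
Proof.
have [le_dn|lt_nd] := leqP d n; last first.
  have -> : h (n%:Z - d%:Z) = 0; last by rewrite mulr0 scaler0; apply: h_positive0.
  by rewrite -(subnK lt_nd) -addSnnS PoszD opprD addrCA subrr addr0.
have part1 (l : seq nat) : hsym_part F N (l ++ nseq d 1%N) = hsym_part F N l * h 1 ^+ d.
  by rewrite /hsym_part big_cat big_nseq iter_mulr_1.
(* For d = n the part n - d is 0 and must be left out of the partition. *)
rewrite subzn //; have [eq_dn|ne_dn] := eqVneq (n - d)%N 0%N.
  exists [:: (c, nseq d 1%N)]; rewrite big_seq1 -[X in hsym_part F N X]cat0s part1.
  rewrite /hsym_part big_nil mul1r eq_dn hsym0 mulr1 /= andbT; split=> //.
  rewrite /is_partition mem_nseq andbF /= sumn_nseq mul1n.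
  rewrite -(eqP (_ : d == n)) ?eqxx ?andbT; last first.
    by rewrite eqn_leq le_dn -subn_eq0 eq_dn.
  by apply/(sortedP 0%N) => i; rewrite size_nseq => lt_id; rewrite !nth_nseq lt_id ltnW.
exists [:: (c, (n - d)%N :: nseq d 1%N)]; rewrite big_seq1 -[X in hsym_part F N X]cat1s part1 mulrC.
rewrite /hsym_part big_seq1 /= andbT; split=> //.
rewrite /is_partition inE mem_nseq andbF orbF eq_sym ne_dn /= sumn_nseq mul1n subnK // eqxx.
rewrite andbT; apply/(pathP 0%N) => i; rewrite size_nseq => lt_id.
case: i lt_id => [|i] lt_id /=; rewrite !nth_nseq lt_id ?(ltnW lt_id) //=.
by rewrite lt0n.
Qed.

Lemma h_positive_smirnov n m : h_positive n (frob N (smirnov_character n m)).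
Proof.
rewrite frob_smirnov; elim/big_ind: _ => [||d _]; first exact: h_positive0.
  exact: h_positiveD.
exact: h_positive_hook.
Qed.

Lemma h_positive_hsym n : h_positive n (h n).
Proof.
have := h_positive_hook n 1 0; by rewrite scale1r mul1r subr0.
Qed.

End HookSums.

(** * Permuted bases *)

Section PermutedFamily.

Variables (F : fieldType) (gT : finGroupType) (V : representation F [set: gT]).
Variables (X : finType) (to : {action gT &-> X}).
Variable b : X -> 'rV[F]_(rdegree V).
Hypothesis b_act : forall g x, b x *m V g = b (to x g).

Definition family_mx : 'M[F]_(#|X|, rdegree V) := \matrix_(a < #|X|) b (enum_val a).
Hypotheses (b_free : row_free family_mx) (b_full : row_full family_mx).

Let card_X : #|X| = rdegree V.
Proof. by rewrite -(eqP b_free) (eqP b_full). Qed.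

Lemma permuted_family_inj : injective b.
Proof.
move=> x y bxy; apply: enum_rank_inj; have [B AB] := row_freeP b_free.
have /(congr1 (fun v => v *m B)) : row (enum_rank x) family_mx = row (enum_rank y) family_mx.
  by rewrite !rowK !enum_rankK.
rewrite -!row_mul AB !row1 => /rowP/(_ (enum_rank x)).
rewrite !mxE !eqxx /=; case: eqP => [->//|_ e]; case/eqP: (oner_neq0 F).
exact: e.
Qed.

Lemma permuted_family_basis :
  exists B, @permuted_basis F gT V B /\ forall i, exists x, row i B = b x.
Proof.
pose B : 'M_(rdegree V) := \matrix_(i < rdegree V) b (enum_val (cast_ord (esym card_X) i)).
have BE i : row i B = b (enum_val (cast_ord (esym card_X) i)) by rewrite rowK.
exists B; split; last by move=> i; rewrite BE; eexists.
split=> [|g i].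
  rewrite -row_full_unit -sub1mx; apply: submx_trans (_ : family_mx <= B)%MS.
    by rewrite sub1mx.
  apply/row_subP => a; rewrite rowK.
  rewrite -[a](cast_ordK card_X) -[cast_ord _ (cast_ord _ _)]/(cast_ord (esym card_X) _) .
  by rewrite (_ : b _ = row (cast_ord card_X a) B) ?row_sub // BE cast_ordK.
rewrite BE b_act; exists (cast_ord card_X (enum_rank (to (enum_val (cast_ord (esym card_X) i)) g))).
by rewrite BE cast_ordK enum_rankK.
Qed.

(** The family intertwines the permutation representation on [X] with [V], and the trace of a
    permutation matrix counts fixed points. *)
Lemma permuted_family_trace g : \tr (V g) = #|[set x | to x g == x]|%:R.
Proof.
have sim : mx_rsim (perm_act_repr F to) V.
  exists family_mx => // h _.
  apply/row_matrixP => a; rewrite !row_mul rowK b_act.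
  by apply/rowP => j; rewrite -row_mul mxE perm_act_mxl mxE enum_rankK.
rewrite -(mxtrace_rsim sim) ?inE // /mxtrace -sum1_card natr_sum.
rewrite [RHS]big_mkcond (reindex _ (onW_bij _ (@enum_rank_bij X))) /=.
by apply: eq_bigr => x _; rewrite !mxE !enum_rankK inE; case: eqP.
Qed.

End PermutedFamily.

Section TrivialQuotient.

Variables (F : fieldType) (gT : finGroupType) (G : {group gT}) (n : nat).
Variables (rG : mx_representation F G n) (U V : 'M[F]_n).
Variables (modU : mxmodule rG U) (modV : mxmodule rG V).
Hypothesis U0 : U = 0.

(** Coordinates of vectors of [V] modulo [U]. It serves in the top degree, where the boundaries are
    0 and no rank is lost. *)
Definition to_section m (W : 'M[F]_(m, n)) : 'M_(m, \rank <<in_factmod U V>>%MS) :=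
  in_submod <<in_factmod U V>>%MS (in_factmod U W).

Lemma row_to_section m (W : 'M[F]_(m, n)) i : row i (to_section W) = to_section (row i W).
Proof. by rewrite /to_section /in_submod /in_factmod /= !row_mul. Qed.

Lemma to_section_act m (W : 'M[F]_(m, n)) g : g \in G -> (W <= V)%MS ->
  to_section (W *m rG g) = to_section W *m section_repr modU modV g.
Proof.
by move=> Gg WV; rewrite /to_section (in_factmodJ modU) //
  (in_submodJ (section_module modU modV)) ?genmxE ?submxMr.
Qed.

Lemma mxrank_to_section m (W : 'M[F]_(m, n)) : (W <= V)%MS ->
  \rank (to_section W) = \rank W.
Proof.
move=> WV; rewrite mxrank_in_submod ?genmxE ?submxMr //.
have := mxrank_in_factmod U W; rewrite U0 mxrank0 addn0 => ->.
by rewrite adds0mx.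
Qed.

Lemma mxrank_section : \rank <<in_factmod U V>>%MS = \rank V.
Proof.
rewrite genmxE; have := mxrank_in_factmod U V; rewrite U0 mxrank0 addn0 => ->.
by rewrite adds0mx.
Qed.

End TrivialQuotient.

(** * Top cycles in subword order *)

Section Deletion.

Variable T : eqType.
Implicit Types s t : seq T.

Definition del p s := take p s ++ drop p.+1 s.

Lemma del_cons p a s : del p.+1 (a :: s) = a :: del p s.
Proof. by []. Qed.

Lemma del0_cons a s : del 0 (a :: s) = s.
Proof. exact: drop0. Qed.

Lemma size_del p s : (p < size s)%N -> size (del p s) = (size s).-1.
Proof.
elim: s p => // a s IHs [|p]; first by rewrite del0_cons.
by move=> ps; rewrite del_cons /= IHs //; case: s ps {IHs}.
Qed.

Lemma subseq_del p s : subseq (del p s) s.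
Proof.
rewrite -[X in subseq _ X](cat_take_drop p s); apply: cat_subseq => //.
by rewrite -add1n -drop_drop; apply: drop_subseq.
Qed.

(** The simplicial identity, source of the cancellation in [sum_boundary_coef]. *)
Lemma del_del p q s : (p <= q)%N -> del q (del p s) = del p (del q.+1 s).
Proof.
elim: s p q => // a s IHs [|p] [|q] //; rewrite ?del_cons ?del0_cons //.
by move=> pq; rewrite IHs.
Qed.

Lemma map_del (T' : Type) (f : T -> T') p s :
  map f (take p s ++ drop p.+1 s) = take p (map f s) ++ drop p.+1 (map f s).
Proof. by rewrite map_cat map_take map_drop. Qed.

Lemma subseq_size_eq s t : subseq s t -> size t = size s -> s = t.
Proof. by move=> st /eqP; rewrite eq_sym (size_subseq_leqif st).2 => /eqP. Qed.

Lemma subseq_cons_cases a t y : subseq y (a :: t) -> size y = size t ->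
  y = t \/ exists2 s, y = a :: s & subseq s t.
Proof.
case: y => [|b s] /=; first by move=> _ /esym/size0nil->; left.
case: eqP => [-> st _|_ st sz]; first by right; exists s.
by left; apply: subseq_size_eq.
Qed.

(* In a word a :: t, a subword one letter above s and above a coatom a :: s is
   forced, because s does not start with a. *)
Lemma between_behead a s t y : smirnov (a :: s) ->
    subseq s y -> subseq y (a :: t) -> size y = size t -> size t = (size s).+1 ->
  y = t \/ y = a :: s.
Proof.
move=> sm sy yt ys ts; have [|[s' ys']] := subseq_cons_cases yt ys; first by left.
right; rewrite ys' in sy ys *; have ss' : size s' = size s by apply: succn_inj; rewrite -ts -ys.
case: s sm sy ts ss' => [|b s] /=; first by move=> _ _ _ /size0nil->.
case/andP=> ab _; rewrite eq_sym (negPf ab) => /subseq_size_eq bs' _ ss'.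
by rewrite bs'.
Qed.

Lemma del_cat s1 s2 y : del (size s1) (s1 ++ y :: s2) = s1 ++ s2.
Proof. by elim: s1 => [|a s1 IHs] /=; rewrite ?del0_cons // del_cons IHs. Qed.

Lemma nth_del x0 p q s : (p <= size s)%N ->
  nth x0 (del p s) q = nth x0 s (bump p q).
Proof.
move=> ps; rewrite nth_cat size_takel // /bump; case: ltnP => qp.
  by rewrite nth_take // leqNgt qp.
by rewrite nth_drop addSn subnKC // qp.
Qed.

(** A simplex lists its elements upwards without the bottom, a descent downwards with the bottom at
    the end; this matches position i of the one with position p of the other. *)
Lemma rcons_rev_del p i s b : size s = (p + i).+1 ->
  rcons (rev (del i s)) b = del p (rcons (rev s) b).
Proof.
move=> sz; have i_lt : (i < size s)%N by rewrite sz ltnS leq_addl.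
case: s sz i_lt => // y0 s0; move: (y0 :: s0) => s sz i_lt.
have szt : size (take i s) = i by rewrite size_takel // ltnW.
have szd : size (rev (drop i.+1 s)) = p by rewrite size_rev size_drop sz subSS addnK.
rewrite /del -[in RHS](cat_take_drop i s) (drop_nth y0 i_lt) rev_cat rev_cat rev_cons.
by rewrite cat_rcons !rcons_cat -[in RHS]szd -/(del _ _) del_cat.
Qed.

End Deletion.

(** The terms (p, q) with p <= q and (q+1, p) have opposite signs and cancel. *)
Lemma alternating_pair_sum (R : pzRingType) m (G : nat -> nat -> R) :
    (forall p q, (p <= q < m)%N -> G p q = G q.+1 p) ->
  \sum_(p < m.+1) \sum_(q < m) (-1) ^+ p * (-1) ^+ q * G p q = 0.
Proof.
move=> GE.
under eq_bigr => p _ do rewrite (bigID (fun q : 'I_m => p <= q)%N) /=.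
rewrite big_split /= [X in _ + X]big_ord_recl /= [X in _ + (X + _)]big1 ?add0r //.
rewrite [X in X + _](_ : _ = \sum_(q < m) \sum_(p < m.+1 | (p <= q)%N)
   (-1) ^+ p * (-1) ^+ q * G p q); last first.
  by rewrite (exchange_big_dep xpredT).
rewrite -big_split big1 //= => q _.
rewrite big_mkcond big_ord_recr /= leqNgt ltn_ord addr0 -big_mkcond /=.
rewrite [X in _ + X](eq_bigl (fun p : 'I_m => (p <= q)%N)) => [|p]; last first.
  by rewrite /bump /= add1n -leqNgt.
rewrite -big_split big1 //= => p pq.
rewrite /bump /= add1n GE ?pq //= exprS !mulN1r !mulNr.
have /commrX/commr_sym/commrX -> : GRing.comm (-1 : R) (-1) by [].
by rewrite subrr.
Qed.

(** * Cycles as functions on maximal descending chains *)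

Section SubwordCycles.

Variables (F : fieldType) (n k : nat).
Notation P := (subword_poset n k).
Implicit Types (x y u v : P) (c lo hi : seq P).

(** The artificial top gets the empty word by default, so equalities of words come with [isSome] to
    exclude it. *)
Definition word x : seq 'I_n := if x is Some u then val u else [::].

Definition covers v u :=
  [&& subseq (word u) (word v), size (word v) == (size (word u)).+1 & isSome u].

Definition descends x c := path covers x c && (word (last x c) == [::]).

Lemma word_inj x y : isSome x -> isSome y -> word x = word y -> x = y.
Proof. by case: x y => [x|//] [y|//] _ _ /= /val_inj->. Qed.

(** No signs appear: the chains summed over differ only in the element y at one position, whose
    deletion carries the same sign in all of them. *)
Definition is_cycle x (z : seq P -> F) := forall hi u lo,
  path covers x hi -> isSome u -> descends u lo ->
  \sum_(y | covers (last x hi) y && covers y u) z (hi ++ y :: u :: lo) = 0.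

Lemma is_cycle_cons x y (z : seq P -> F) : covers x y ->
  is_cycle x z -> is_cycle y (z \o cons y).
Proof. by move=> xy cz hi u lo yhi u_ulo; apply: (cz (y :: hi)); rewrite //= xy. Qed.

Definition tail x : P := omap (fun u : k.-bseq 'I_n =>
  Bseq (leq_trans (leq_trans (eq_leq (size_behead u)) (leq_pred _)) (size_bseq u))) x.

Lemma word_tail x : word (tail x) = behead (word x).
Proof. by case: x. Qed.

Lemma isSome_tail x : isSome (tail x) = isSome x.
Proof. by case: x. Qed.

Definition suffix_chain x := traject tail (tail x) (size (word x)).

Lemma suffix_chainE x a t : word x = a :: t ->
  suffix_chain x = tail x :: suffix_chain (tail x).
Proof. by move=> xat; rewrite /suffix_chain word_tail xat. Qed.

Lemma covers_tail x a t : isSome x -> word x = a :: t -> covers x (tail x).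
Proof.
by move=> sx xat; rewrite /covers isSome_tail sx word_tail xat subseq_cons eqxx.
Qed.

Lemma descends_suffix_chain x : isSome x -> descends x (suffix_chain x).
Proof.
move: {2}(size _) (erefl (size (word x))) => m; elim: m x => [|m IHm] x sz sx.
  by rewrite /suffix_chain sz /descends /= -size_eq0 sz.
case xat: (word x) sz => [//|a t] /= [sz].
rewrite (suffix_chainE xat) /descends /= (covers_tail sx xat).
by apply: IHm; rewrite ?isSome_tail // word_tail xat.
Qed.

Lemma covers_cases x a t y : isSome x -> word x = a :: t -> covers x y ->
  y = tail x \/ exists2 s, word y = a :: s & subseq s t.
Proof.
move=> sx xat /and3P[]; rewrite xat eqSS => yx /eqP sz sy.
have [yt|] := subseq_cons_cases yx (esym sz); [left | by right].
by apply: word_inj; rewrite ?isSome_tail // word_tail xat.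
Qed.

(** Induction on the length of the word. A chain starts with the tail of [x] or with a coatom having
    the same first letter; the first kind is settled first, and the cycle condition reduces the
    second to it. *)
Lemma cycle_eq0 x (z : seq P -> F) : isSome x -> is_cycle x z ->
    (smirnov (word x) -> z (suffix_chain x) = 0) ->
  forall c, descends x c -> z c = 0.
Proof.
move: {2}(size _) (erefl (size (word x))) => m.
elim: m x z => [|m IHm] x z sz sx cz zs c.
  move/size0nil: sz => x0; case: c => [|y c].
    by move: zs; rewrite /suffix_chain x0 /= => ->.
  by rewrite /descends /= /covers x0 andbF.
case xat: (word x) sz => [//|a t] /= [sz].
have tx := covers_tail sx xat; have st : isSome (tail x) by rewrite isSome_tail.
have wt : word (tail x) = t by rewrite word_tail xat.
have z_tail lo : descends (tail x) lo -> z (tail x :: lo) = 0.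
  apply: (IHm _ (z \o cons (tail x))); rewrite ?wt //; first exact: (is_cycle_cons tx cz).
  move=> sm_t /=; case sm_x: (smirnov (word x)).
    by rewrite -(suffix_chainE xat) zs.
  case: t => [|b t] in sz xat wt sm_t *; first by rewrite xat in sm_x.
  (* If the tail is Smirnov and the word is not, the first letter is repeated. Then only [tail x]
     lies between [x] and [tail (tail x)], and the cycle condition has a single term. *)
  have ab : a = b.
    apply/eqP/negbFE; move: sm_x sm_t; rewrite xat /smirnov /= => + sm_t.
    by rewrite sm_t andbT.
  subst b; set u := tail (tail x).
  have wu : word u = t by rewrite word_tail wt.
  have su : isSome u by rewrite isSome_tail.
  have := cz [::] u (suffix_chain u) isT su (descends_suffix_chain su).
  rewrite (suffix_chainE wt) (bigD1 (tail x)) /= ?tx ?(covers_tail st wt) //.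
  rewrite big1 ?addr0 // => y /andP[/andP[xy yu] /eqP ne]; case: ne.
  have /and3P[uy /eqP sz_y _] := yu; have /and3P[yx /eqP sz_x sy] := xy.
  apply: word_inj => //. rewrite wt.
  rewrite wu in uy sz_y; rewrite xat in yx.
  by have [] := between_behead sm_t uy yx sz_y.
case: c => [|y c]; first by rewrite /descends /= xat.
case/andP=> /= /andP[xy yc] lastc.
have yc' : descends y c by rewrite /descends yc.
have [yt|[s ys _]] := covers_cases sx xat xy; first by rewrite yt in yc' *; apply: z_tail.
have sy : isSome y by case/and3P: xy.
have sz_y : size (word y) = m by case/and3P: xy => _ /eqP; rewrite xat /= sz => -[].
apply: (IHm _ (z \o cons y)) yc' => //; first exact: (is_cycle_cons xy cz).
(* By [between_behead] only [y] and [tail x] can lie between [x] and [u]; chains through [tail x]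
   have value 0, so the cycle condition leaves only the value at [y]. *)
move=> sm_y /=; rewrite (suffix_chainE ys); set u := tail y.
have wu : word u = s by rewrite word_tail ys.
have su : isSome u by rewrite isSome_tail.
have := cz [::] u (suffix_chain u) isT su (descends_suffix_chain su).
rewrite (bigD1 y) /= ?xy ?(covers_tail sy ys) // big1 ?addr0 // => v /andP[/andP[xv vu] vy].
have [vt|] := eqVneq v (tail x).
  rewrite vt; apply: z_tail; rewrite /descends /= -vt vu.
  exact: descends_suffix_chain.
have /and3P[uv /eqP sz_v _] := vu; have /and3P[vx /eqP sz_x sv] := xv.
rewrite wu in uv sz_v; rewrite xat in vx sz_x; rewrite ys in sm_y.
have sz_vt : size (word v) = size t by apply: succn_inj; rewrite -sz_x.
have [vt|vys] := between_behead sm_y uv vx sz_vt (etrans (esym sz_vt) sz_v).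
  by case/eqP; apply: word_inj; rewrite ?vt.
by case/eqP: vy; apply: word_inj; rewrite ?ys.
Qed.

(** A signed count of positions, since deleting different letters of a run of equal letters gives
    the same word. *)
Definition boundary_coef v u : F :=
  \sum_(p < size (word v) | del p (word v) == word u) (-1) ^+ p.

(* The image of the fundamental cycle of the Boolean lattice of subsets of the
   positions of x, under the map sending a subset to the corresponding subword. *)
Fixpoint boolean_cycle x c : F :=
  if c is y :: c' then boundary_coef x y * boolean_cycle y c' else 1.

Definition of_word (s : seq 'I_n) : P := Some (insub_bseq k s).

Lemma word_of_word s : (size s <= k)%N -> word (of_word s) = s.
Proof. by move=> sk; rewrite /= /insub_bseq insubdK. Qed.

Lemma size_word_le x : (size (word x) <= k)%N.
Proof. by case: x => [x|//]; apply: size_bseq. Qed.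

Lemma of_wordK x : isSome x -> of_word (word x) = x.
Proof. by move=> sx; apply: word_inj; rewrite // word_of_word ?size_word_le. Qed.

Lemma boundary_coef_neq0 v u : isSome u -> boundary_coef v u != 0 -> covers v u.
Proof.
move=> su; apply: contraNT => Nvu; rewrite /boundary_coef big_pred0 // => p.
apply: contraNF Nvu => /eqP vu; rewrite /covers su -vu subseq_del size_del //.
by rewrite prednK ?eqxx //; apply: leq_ltn_trans (ltn_ord p).
Qed.

(** The sum runs over successive deletions at two positions leading from [v] to [u]; exchanging
    their order cancels them in pairs. *)
Lemma sum_boundary_coef v u : isSome u ->
  \sum_(y | covers v y && covers y u) boundary_coef v y * boundary_coef y u = 0.
Proof.
move=> su; case: (pickP (fun y => covers v y && covers y u)) => [y0|no]; last first.
  by rewrite big_pred0.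
case/andP=> /and3P[_ /eqP sz_v _] /and3P[_ /eqP sz_y _].
set m := size (word u) in sz_y; rewrite sz_y in sz_v.
(* Off the covering relation a coefficient is 0, so y may be any word. *)
transitivity (\sum_(y | isSome y) boundary_coef v y * boundary_coef y u).
  rewrite big_mkcond [RHS]big_mkcond; apply: eq_bigr => y _.
  case vu: (_ && _); first by case/andP: vu => /and3P[_ _ ->].
  case: ifP => // sy; apply/esym/eqP; apply: contraFT vu.
  rewrite mulf_eq0 negb_or => /andP[/(boundary_coef_neq0 sy)->].
  exact: boundary_coef_neq0.
rewrite -[RHS](@alternating_pair_sum F m.+1
  (fun p q => (del q (del p (word v)) == word u)%:R)); last first.
  by move=> p q /andP[pq _]; rewrite del_del.
under eq_bigr do rewrite /boundary_coef big_distrl /=.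
rewrite (exchange_big_dep xpredT) //= sz_v; apply: eq_bigr => p _.
have sz_d : size (del p (word v)) = m.+1 by rewrite size_del ?sz_v.
have dK : word (of_word (del p (word v))) = del p (word v).
  by rewrite word_of_word // sz_d (leq_trans _ (size_word_le v)) // sz_v.
rewrite (big_pred1 (of_word (del p (word v)))) => [|y]; last first.
  apply/andP/eqP => [[sy /eqP->]|->]; first by rewrite of_wordK.
  by rewrite dK.
rewrite /boundary_coef dK sz_d big_mkcond mulr_sumr; apply: eq_bigr => q _.
by case: eqP => _; rewrite ?mulr1 // !mulr0.
Qed.

(** Only the two factors next to y depend on it, and their products sum to 0 by
    [sum_boundary_coef]. *)
Lemma boolean_cycle_is_cycle x : is_cycle x (boolean_cycle x).
Proof.
move=> hi u lo; elim: hi x => [|y hi IHhi] x /=.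
  move=> _ su _; under eq_bigr do rewrite mulrA.
  by rewrite -mulr_suml sum_boundary_coef // mul0r.
by case/andP=> _ yhi su ulo; rewrite -mulr_sumr IHhi // mulr0.
Qed.

Lemma boolean_cycle_suffix x : isSome x -> smirnov (word x) ->
  boolean_cycle x (suffix_chain x) = 1.
Proof.
move: {2}(size _) (erefl (size (word x))) => m; elim: m x => [|m IHm] x sz sx sm.
  by rewrite /suffix_chain sz.
case xat: (word x) sz => [//|a t] /= [sz]; rewrite (suffix_chainE xat) /=.
have wt : word (tail x) = t by rewrite word_tail xat.
rewrite IHm ?wt ?isSome_tail //; last first.
  by move: sm; rewrite xat /smirnov /=; apply: path_sorted.
rewrite mulr1 /boundary_coef xat wt big_mkcond big_ord_recl del0_cons eqxx big1 /= ?addr0 //.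
(* Deleting a later letter keeps the first letter, whereas the tail of a Smirnov word starts with a
   different one. *)
move=> p _; rewrite del_cons.
case: t sm xat {sz wt} p => [|b t] sm xat p; first by case: p.
by move: sm; rewrite xat /smirnov /= => /andP[/negPf ab _]; rewrite eqseq_cons ab.
Qed.

Lemma word_act (g : 'S_n) x : word (subword_action n k x g) = map g (word x).
Proof. by case: x. Qed.

(** The coefficients depend on positions only, and renaming the letters respects these; hence no
    sign. *)
Lemma boolean_cycle_act (g : 'S_n) x c : isSome x -> all isSome c ->
  boolean_cycle (subword_action n k x g) [seq subword_action n k y g | y <- c] =
  boolean_cycle x c.
Proof.
elim: c x => //= y c IHc x sx /andP[sy sc]; rewrite IHc //; congr (_ * _).
rewrite /boundary_coef !word_act size_map; apply: eq_bigl => p.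
by rewrite /del -map_del (inj_eq (inj_map (@perm_inj _ g))).
Qed.

End SubwordCycles.

Lemma smirnov_map (T T' : eqType) (f : T -> T') (s : seq T) :
  injective f -> smirnov (map f s) = smirnov s.
Proof.
move=> f_inj; rewrite /smirnov sorted_map; apply: eq_sorted => a b /=.
by rewrite (inj_eq f_inj).
Qed.

Section SmirnovWords.

Variables n m : nat.

Definition smirnov_word : predArgType := {t : m.-tuple 'I_n | smirnov t}.
HB.instance Definition _ := Finite.on smirnov_word.

Fact smirnov_word_act_proof (t : smirnov_word) (g : 'S_n) :
  smirnov (map_tuple g (val t)).
Proof. by rewrite smirnov_map ?(valP t) //; apply: perm_inj. Qed.

Definition smirnov_word_act (t : smirnov_word) (g : 'S_n) : smirnov_word :=
  Sub (map_tuple g (val t)) (smirnov_word_act_proof t g).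

Fact smirnov_word_is_action : is_action [set: 'S_n] smirnov_word_act.
Proof.
apply: is_total_action => [t|t g h]; apply/val_inj/val_inj => /=.
  by rewrite (eq_map (g := id)) ?map_id // => i; rewrite perm1.
by rewrite -map_comp; apply: eq_map => i; rewrite permM.
Qed.

Definition smirnov_word_action : {action 'S_n &-> smirnov_word} :=
  Action smirnov_word_is_action.

End SmirnovWords.

Lemma card_fixed_smirnov n m (w : 'S_n) :
  #|[set t : smirnov_word n m.+1 | smirnov_word_action n m.+1 t w == t]| =
  (fixpoints w * (fixpoints w).-1 ^ m)%N.
Proof.
rewrite -card_smirnov -(card_imset _ val_inj); apply: eq_card => t.
have fixE (u : seq 'I_n) : all (mem [set i | w i == i]) u = (map w u == u).
  apply/allP/eqP => [wu|wu i iu].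
    by apply: map_id_in => i iu; have := wu i iu; rewrite /= inE => /eqP.
  by rewrite /= inE; apply/eqP/(proj2 (eq_in_map w id u)) => //; rewrite map_id.
rewrite inE fixE; apply/imsetP/andP => [[s]|[sm /eqP wt]].
  rewrite inE => /eqP ws ->; split; first exact: (valP s).
  by apply/eqP; have := congr1 (fun u : smirnov_word n m.+1 => tval (val u)) ws.
by exists (Sub t sm) => //; rewrite inE; apply/eqP/val_inj/val_inj.
Qed.

(** * From simplices of intervals to descending chains *)

Section WhitneyHomology.

Variables (F : fieldType) (n k m : nat).
Hypothesis lt_mk : (m < k)%N.
Notation P := (subword_poset n k).
Notation IC := (interval_chain (@subword_rank n k)).
Notation word := (@word n k).
Notation covers := (@covers n k).
Notation descends := (@descends n k).

Lemma lt_covers (u v : P) : covers v u -> (u < v)%O.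
Proof.
case/and3P=> uv /eqP sz; case: u uv sz => // u; case: v => [v|] //= uv sz _.
rewrite Order.POrderTheory.lt_def; apply/andP; split=> //.
by apply/eqP => -[vu]; move: sz; rewrite vu => /n_Sn.
Qed.

Lemma lt_rank (u v : P) : (u < v)%O -> (subword_rank u < subword_rank v)%N.
Proof.
rewrite Order.POrderTheory.lt_def => /andP[vu]; case: v u vu => [v|] [u|] //= vu uv.
  rewrite ltn_neqAle size_subseq // andbT; apply: contraNN vu => /eqP uv_sz.
  by apply/eqP; congr Some; apply/val_inj/esym/subseq_size_eq.
by rewrite ltnS size_bseq.
Qed.

Lemma lt_coversE (u v : P) : (subword_rank v <= k)%N -> (u < v)%O ->
  subword_rank v = (subword_rank u).+1 -> covers v u.
Proof.
case: v u => [v|] [u|] //= vk; try by rewrite ltnn in vk.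
by move=> /Order.POrderTheory.ltW uv sz; rewrite /covers /= sz eqxx !andbT.
Qed.

Lemma path_rank (u : P) s : path <%O u s ->
  (subword_rank u + size s <= subword_rank (last u s))%N.
Proof.
elim: s u => [|v s IHs] u /=; first by rewrite addn0.
case/andP=> /lt_rank uv /IHs; apply: leq_trans.
by rewrite -addSnnS leq_add2r.
Qed.

(** A chain with as many steps as the rank difference allows must raise the rank by exactly one each
    time. *)
Lemma path_covers (u : P) s : path <%O u s ->
    (subword_rank (last u s) <= subword_rank u + size s)%N ->
    (subword_rank (last u s) <= k)%N ->
  path (fun x y => covers y x) u s.
Proof.
elim: s u => [|v s IHs] u //= /andP[uv vs] le1 le2.
have rv : subword_rank v = (subword_rank u).+1.
  apply/eqP; rewrite eqn_leq lt_rank // andbT -(leq_add2r (size s)) addSnnS.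
  exact: leq_trans (path_rank vs) le1.
rewrite IHs ?rv ?addSnnS // andbT; apply: lt_coversE => //.
by apply: leq_trans (leq_trans (path_rank vs) le2); rewrite leq_addr.
Qed.

(** The form used in [descends]: downwards, with the bottom added and the upper end [(val a).1] left
    out. *)
Definition descent r q (a : IC r q) : seq P := rcons (rev (val a).2) Order.bottom.

Lemma descent_inj r q (a b : IC r q) :
  (val a).1 = (val b).1 -> descent a = descent b -> a = b.
Proof.
move=> ab /rcons_inj[/(can_inj revK) cab].
case: a b ab cab => -[x c] xc [[y d] yd] /= xy cd; apply: val_inj => /=.
by congr pair => //; apply: val_inj.
Qed.

Lemma interval_chainP (a : IC m.+1 m) :
  [/\ isSome (val a).1, size (word (val a).1) = m.+1 & descends (val a).1 (descent a)].
Proof.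
case: a => -[x c] /= ac; have /andP[/= /eqP rx pc] := ac.
have sx : isSome x.
  (* The artificial top has rank k+1, which exceeds m+1. *)
  by case: x rx {ac pc} => // rx; have := lt_mk; rewrite -ltnS -rx ltnn.
split=> //; first by case: x rx sx {ac pc}.
rewrite /descends /descent /= last_rcons /= andbT.
have := path_covers pc; rewrite last_rcons rx size_rcons size_tuple leqnn lt_mk.
move=> /(_ isT isT); rewrite -rev_path last_rcons belast_rcons rev_cons.
by apply: sub_path.
Qed.

Lemma size_descends (x : P) c : descends x c -> size c = size (word x).
Proof.
case/andP; elim: c x => [|y c IHc] x /=; first by move=> _ /eqP->.
by case/andP=> /and3P[_ /eqP-> _] yc lc; rewrite (IHc _ yc lc).
Qed.

Lemma interval_chain_of_descends (x : P) c : isSome x -> size (word x) = m.+1 ->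
    descends x c ->
  exists2 a : IC m.+1 m, (val a).1 = x & descent a = c.
Proof.
move=> sx sz xc; have sz_c := size_descends xc; rewrite sz in sz_c.
case/lastP: c xc sz_c => // c bot; rewrite /descends rcons_path last_rcons size_rcons.
move=> /andP[/andP[xc cb] /eqP bot0] [sz_c].
have sb : isSome bot by case/and3P: cb.
have bot_bot : bot = Order.bottom by apply: word_inj.
have sz_rev : size (rev c) == m by rewrite size_rev sz_c.
have ac : is_interval_chain (@subword_rank n k) m.+1 (x, Tuple sz_rev).
  rewrite /is_interval_chain /=; apply/andP; split.
    by case: x sx sz {xc cb} => //= x _ ->.
  have : path covers x (rcons c bot) by rewrite rcons_path xc.
  rewrite -rev_path last_rcons belast_rcons rev_cons bot_bot.
  by apply: sub_path => u v; apply: lt_covers.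
by exists (Sub _ ac); rewrite // /descent /= revK bot_bot.
Qed.

Lemma size_descent r q (a : IC r q) : size (descent a) = q.+1.
Proof. by rewrite size_rcons size_rev size_tuple. Qed.

Lemma size_word_nth (x : P) c q : path covers x c -> (q < size c)%N ->
  (size (word (nth Order.bottom c q)) + q.+1)%N = size (word x).
Proof.
elim: c x q => // y c IHc x [|q] /= /andP[/and3P[_ /eqP-> _] yc] qc; first by rewrite addn1.
by rewrite -(IHc _ _ yc qc) addnS.
Qed.

(** Simplices over the same word sharing the facet opposite to position p, counted from the top; p <
    m spares the bottom element. *)
Definition same_facet p (a b : IC m.+1 m) :=
  ((val a).1 == (val b).1) && (del p (descent a) == del p (descent b)).

(** A facet skips exactly one rank, which reveals the deleted position. *)
Lemma same_facet_dim p q (a b : IC m.+1 m) : (p < m)%N -> (q < m)%N ->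
  del p (descent a) = del q (descent b) -> p = q.
Proof.
wlog pq : a b p q / (p < q)%N.
  move=> H pm qm eqab; case: (ltngtP p q) => // [pq|qp]; first exact: H eqab.
  exact/esym/(H b a).
move=> pm qm /(congr1 (fun c => size (word (nth Order.bottom c p)))).
have sz (c : IC m.+1 m) r : (r < m)%N -> (r <= size (descent c))%N.
  by move=> rm; rewrite size_descent ltnW // ltnW.
rewrite (nth_del _ _ (sz a p pm)) (nth_del _ _ (sz b q qm)).
rewrite /bump leqnn leqNgt pq /= add0n add1n => e.
have [_ sza /andP[pa _]] := interval_chainP a; have [_ szb /andP[pb _]] := interval_chainP b.
have := size_word_nth pa (q := p.+1); rewrite size_descent ltnS pm e sza => /(_ isT).
have := size_word_nth pb (q := p); rewrite size_descent ltnS (ltnW pm) szb => /(_ isT) eb.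
by rewrite addnS eb => /esym/n_Sn.
Qed.

(** Replacing the element at position [size hi] by any y between its neighbours runs through all
    simplices with the same facet. *)
Lemma sum_same_facet (a0 : IC m.+1 m) hi y0 u lo (phi : seq P -> F) :
    descent a0 = hi ++ y0 :: u :: lo ->
  \sum_(a | same_facet (size hi) a a0) phi (descent a) =
  \sum_(y | covers (last (val a0).1 hi) y && covers y u) phi (hi ++ y :: u :: lo).
Proof.
move=> a0E; have [sx szx xa0] := interval_chainP a0.
pose h y := odflt a0 [pick a : IC m.+1 m |
  ((val a).1 == (val a0).1) && (descent a == hi ++ y :: u :: lo)].
move: xa0; rewrite a0E /descends cat_path last_cat /=.
case/andP=> /and4P[xhi _ _ ulo] lastlo.
have hE y : covers (last (val a0).1 hi) y && covers y u ->
    (val (h y)).1 = (val a0).1 /\ descent (h y) = hi ++ y :: u :: lo.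
  case/andP=> vy yu; rewrite /h; case: pickP => [a /andP[/eqP-> /eqP->] //|no].
  have [|a ax aE] := interval_chain_of_descends (c := hi ++ y :: u :: lo) sx szx.
    by rewrite /descends cat_path last_cat /= xhi vy yu ulo.
  by have := no a; rewrite ax aE !eqxx.
have facetE a : same_facet (size hi) a a0 ->
    descent a = hi ++ nth Order.bottom (descent a) (size hi) :: u :: lo.
  case/andP=> _ /eqP hd; set y := nth _ _ _.
  have lt_hi : (size hi < size (descent a))%N.
    by rewrite size_descent -(size_descent a0) a0E size_cat /= -addSnnS leq_addr.
  have sz_hi : size (take (size hi) (descent a)) = size hi by rewrite size_takel // ltnW.
  move: hd; rewrite a0E del_cat /del => /eqP; rewrite eqseq_cat // => /andP[/eqP ht /eqP hd].
  by rewrite -[LHS](cat_take_drop (size hi)) (drop_nth Order.bottom lt_hi) ht hd.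
rewrite (reindex_onto h (fun a => nth Order.bottom (descent a) (size hi))) /=; last first.
  move=> a aa0; have aE := facetE a aa0; have [_ _ da] := interval_chainP a.
  have /andP[/eqP ax _] := aa0.
  rewrite aE /descends ax cat_path /= in da; have /andP[/and4P[_ vy yu _] _] := da.
  have [hx hd] := hE _ (introT andP (conj vy yu)).
  exact: descent_inj (etrans hx (esym ax)) (etrans hd (esym aE)).
apply: eq_big => [y|y /andP[hy0 /eqP hy]]; last by rewrite (facetE _ hy0) hy.
apply/andP/idP => [[hy0 /eqP hy]|vyu].
  have [_ _] := interval_chainP (h y); have /andP[/eqP hx _] := hy0.
  rewrite (facetE _ hy0) hy hx /descends cat_path /=.
  by case/andP=> /and4P[_ -> -> _].
have [hx hd] := hE y vyu.
by rewrite /same_facet hx hd a0E !del_cat !eqxx nth_cat ltnn subnn /=.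
Qed.

(** By [same_facet_dim] a facet arises by deletion at one position only, so an entry of the product
    is, up to sign, a single unsigned sum. *)
Lemma boundary_mx0P (z : IC m.+1 m -> F) :
  (\row_a z (enum_val a)) *m boundary F (@subword_rank n k) m.+1 m = 0 <->
  forall a0 p, (p < m)%N -> \sum_(a | same_facet p a a0) z a = 0.
Proof.
(* Position i from the bottom is position m - i.+1 from the top. *)
have facet_descent (a : IC m.+1 m) (i : 'I_m) :
    rcons (rev (del i (val a).2)) Order.bottom = del (m - i.+1) (descent a).
  by apply: rcons_rev_del; rewrite size_tuple -addnS subnK.
have entryE b : ((\row_a z (enum_val a)) *m boundary F (@subword_rank n k) m.+1 m) 0 b =
    \sum_(i < m) (-1) ^+ i * \sum_(a : IC m.+1 m | ((val (enum_val b)).1 == (val a).1)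
      && (val (val (enum_val b)).2 == del i (val a).2)) z a.
  rewrite mxE (reindex _ (onW_bij _ (@enum_rank_bij _))) /=.
  under eq_bigr => a _.
    rewrite !mxE enum_rankK.
    rewrite (_ : (let: (x, c) := val a in _) = \sum_(i < m) (-1) ^+ i *
      (((val (enum_val b)).1 == (val a).1)
      && (val (val (enum_val b)).2 == del i (val a).2))%:R); last first.
      by case: (val a) => x c; case: (val (enum_val b)).
    rewrite mulr_sumr.
  over.
  rewrite exchange_big; apply: eq_bigr => i _; rewrite mulr_sumr [RHS]big_mkcond.
  by apply: eq_bigr => a _; case: (_ && _); rewrite ?mulr1 ?mulr0 // mulrC.
have sameE (a a0 : IC m.+1 m) (i : 'I_m) : same_facet (m - i.+1) a a0 =
    ((val a0).1 == (val a).1) && (del i (val a0).2 == del i (val a).2).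
  rewrite /same_facet eq_sym; congr (_ && _).
  rewrite -!facet_descent eqseq_rcons eqxx andbT (inj_eq (can_inj revK)).
  by rewrite eq_sym.
split=> [z0 a0 p pm|z0]; last first.
  apply/rowP => b; rewrite entryE mxE big1 // => i _.
  case: (pickP (fun a : IC m.+1 m => ((val (enum_val b)).1 == (val a).1)
      && (val (val (enum_val b)).2 == del i (val a).2))) => [a0|no]; last first.
    by rewrite big_pred0 ?mulr0.
  case/andP=> /eqP ba /eqP bd; suff -> : \sum_(a : IC m.+1 m | ((val (enum_val b)).1 == (val a).1)
      && (val (val (enum_val b)).2 == del i (val a).2)) z a
    = \sum_(a | same_facet (m - i.+1) a a0) z a.
    by rewrite z0 ?mulr0 // ltn_subrL /= (leq_trans _ (ltn_ord i)).
  by apply: eq_bigl => a; rewrite ba bd sameE.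
have i_lt : (m - p.+1 < m)%N by rewrite ltn_subrL (leq_trans _ pm).
pose i := Ordinal i_lt; have pE : p = (m - i.+1)%N by rewrite /= -subSn // subKn // ltnW.
have sz_e : size (del i (val a0).2) == m.-1 by rewrite size_del size_tuple.
have be : is_interval_chain (@subword_rank n k) m.+1 ((val a0).1, Tuple sz_e).
  have /andP[rx a0c] := valP a0; apply/andP; split; first exact: rx.
  apply: (subseq_path (@Order.POrderTheory.lt_trans _ P)) a0c.
  by rewrite -!cats1 cat_subseq ?subseq_del.
have /rowP/(_ (enum_rank (Sub _ be : IC m.+1 m.-1))) := z0.
rewrite entryE mxE enum_rankK (bigD1 i) //= [X in _ + X]big1 ?addr0 => [|j ji].
  move/eqP; rewrite mulf_eq0 signr_eq0 /= => /eqP z_e; rewrite -[RHS]z_e.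
  by apply: eq_bigl => a; rewrite [in LHS]pE sameE.
rewrite big_pred0 ?mulr0 // => a; apply: contraNF ji => /andP[_ /eqP eqe].
have eqd : del (m - i.+1) (descent a0) = del (m - j.+1) (descent a).
  by rewrite -!facet_descent; congr (rcons (rev _) _).
have sub_lt (l : 'I_m) : (m - l.+1 < m)%N by rewrite ltn_subrL (leq_trans _ (ltn_ord l)).
have := same_facet_dim (sub_lt _) (sub_lt _) eqd.
move/(congr1 (subn m)); rewrite !subKn ?ltn_ord // => -[ij].
by apply/eqP/val_inj; rewrite /= ij.
Qed.

Definition suffix_word (t : smirnov_word n m.+1) : P := of_word k (val t).

Definition boolean_row (x : P) : 'rV[F]_#|IC m.+1 m| :=
  \row_a (if (val (enum_val a)).1 == x then boolean_cycle F x (descent (enum_val a)) else 0).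

Lemma descent_split (a : IC m.+1 m) p : (p < m)%N ->
  exists hi y u lo, [/\ descent a = hi ++ y :: u :: lo, size hi = p,
    path covers (val a).1 hi, isSome u & descends u lo].
Proof.
move=> pm; set d := descent a; have szd : size d = m.+1 := size_descent a.
exists (take p d), (nth Order.bottom d p), (nth Order.bottom d p.+1), (drop p.+2 d).
have dE : d = take p d ++ nth Order.bottom d p :: nth Order.bottom d p.+1 :: drop p.+2 d.
  by rewrite -!drop_nth ?szd ?cat_take_drop // ltnS ltnW.
have [_ _] := interval_chainP a; rewrite -/d {1}dE /descends cat_path last_cat /=.
case/andP=> /and4P[phi _ /and3P[_ _ su] plo] llo.
by split=> //; [rewrite size_takel // szd ltnW // ltnW | rewrite /descends plo].
Qed.

Lemma boolean_row_cycle (x : P) : (boolean_row x <= cycles F (@subword_rank n k) m.+1 m)%MS.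
Proof.
apply/sub_kermxP; apply/(boundary_mx0P (fun a : IC m.+1 m =>
  if (val a).1 == x then boolean_cycle F x (descent a) else 0)) => a0 p pm.
have [ax|/eqP nax] := eqVneq (val a0).1 x; last first.
  by rewrite big1 // => a /andP[/eqP-> _]; case: eqP.
have [hi [y [u [lo [dE <- xhi su ulo]]]]] := descent_split a0 pm.
rewrite (eq_bigr (fun a => boolean_cycle F x (descent a))) => [|a /andP[/eqP-> _]].
  by rewrite (sum_same_facet _ dE) ax; apply: boolean_cycle_is_cycle; rewrite // -ax.
by rewrite ax eqxx.
Qed.

Lemma cycle_row_eq0 (z : IC m.+1 m -> F) :
    (\row_a z (enum_val a)) *m boundary F (@subword_rank n k) m.+1 m = 0 ->
    (forall a : IC m.+1 m, smirnov (word (val a).1) ->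
       descent a = suffix_chain (val a).1 -> z a = 0) ->
  forall a, z a = 0.
Proof.
move=> /boundary_mx0P z0 zs a1; have [sx szx xa1] := interval_chainP a1.
set x := (val a1).1 in sx szx xa1.
(* At most one simplex over [x] has a given descent, so [zx] is [z] read on sequences, and 0 where
   there is no simplex. *)
pose zx c := \sum_(a : IC m.+1 m | ((val a).1 == x) && (descent a == c)) z a.
have zxE a : (val a).1 = x -> zx (descent a) = z a.
  move=> ax; rewrite /zx (big_pred1 a) // => b; apply/andP/eqP => [[/eqP bx /eqP bd]|->].
    by apply: descent_inj; rewrite // bx.
  by rewrite ax !eqxx.
rewrite -zxE //; apply: (@cycle_eq0 F n k x zx sx) xa1; last first.
  move=> sm; rewrite /zx big1 // => a /andP[/eqP ax /eqP ad].
  by apply: zs; rewrite ax.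
move=> hi u lo xhi su ulo; case: (pickP (fun y => covers (last x hi) y && covers y u)) =>
  [y0 /andP[vy yu]|no]; last by rewrite big_pred0.
have x_chain : descends x (hi ++ y0 :: u :: lo).
  by case/andP: ulo => ulo lo0; rewrite /descends cat_path last_cat /= xhi vy yu ulo.
have [a0 ax dE] := interval_chain_of_descends sx szx x_chain.
have lt_hi : (size hi < m)%N.
  have := size_descent a0; rewrite dE size_cat /= !addnS => -[<-].
  by rewrite ltnS leq_addr.
rewrite -[in LHS]ax -(sum_same_facet zx dE) -[RHS](z0 a0 _ lt_hi).
by apply: eq_bigr => a /andP[/eqP aa0 _]; rewrite zxE // aa0.
Qed.

End WhitneyHomology.

(** * The permuted basis of Whitney homology *)

Section WhitneyBasis.

Variables (F : fieldType) (n k m : nat).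
Hypothesis lt_mk : (m < k)%N.
Notation P := (subword_poset n k).
Notation IC := (interval_chain (@subword_rank n k)).
Notation X := (smirnov_word n m.+1).
Notation WH := (subword_WH F n k m.+1).
Notation px := (@suffix_word n k m).

Let word_px (t : X) : word (px t) = val t.
Proof. by rewrite word_of_word // size_tuple. Qed.

Let px_inj : injective px.
Proof.
by move=> s t /(congr1 (@word n k)); rewrite !word_px => /val_inj/val_inj.
Qed.

Let px_act (t : X) g : px (smirnov_word_action n m.+1 t g) = subword_action n k (px t) g.
Proof.
by apply: word_inj => //; rewrite word_act !word_px.
Qed.

Definition boolean_mx : 'M[F]_(#|{: X}|, #|{: IC m.+1 m}|) :=
  \matrix_(a < #|{: X}|) boolean_row F m (px (enum_val a)).

Let suffix_elements : exists sa : X -> IC m.+1 m,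
  forall t, (val (sa t)).1 = px t /\ descent (sa t) = suffix_chain (px t).
Proof.
apply: (fin_all_exists (P := fun t (a : IC m.+1 m) =>
  (val a).1 = px t /\ descent a = suffix_chain (px t))) => t.
have sz : size (word (px t)) = m.+1 by rewrite word_px size_tuple.
have spx : isSome (px t) by [].
have [a ax ad] := interval_chain_of_descends spx sz (descends_suffix_chain spx).
by exists a.
Qed.

(** An identity matrix: the Boolean cycles are independent, and the values of a cycle on the suffix
    chains will be its coordinates. *)
Let boolean_row_suffix (sa : X -> IC m.+1 m) s t :
    (forall t, (val (sa t)).1 = px t /\ descent (sa t) = suffix_chain (px t)) ->
  boolean_row F m (px s) 0 (enum_rank (sa t)) = (s == t)%:R.
Proof.
move=> saP; rewrite mxE enum_rankK; have [-> ->] := saP t.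
rewrite (inj_eq px_inj) eq_sym; case: eqP => [->|//].
by rewrite boolean_cycle_suffix // word_px; apply: (valP t).
Qed.

Lemma row_free_boolean_mx : row_free boolean_mx.
Proof.
have [sa saP] := suffix_elements.
apply/row_freeP; exists (\matrix_(a, b) (enum_val a == sa (enum_val b))%:R).
apply/matrixP => a b; rewrite mxE (bigD1 (enum_rank (sa (enum_val b)))) //= big1.
  rewrite addr0 [X in _ * X]mxE enum_rankK eqxx mulr1 [LHS]mxE.
  rewrite (boolean_row_suffix (sa := sa)) // mxE (inj_eq enum_val_inj).
  by [].
move=> c cb; rewrite [X in _ * X]mxE; case: eqP => [e|_]; last by rewrite mulr0.
by rewrite -e enum_valK eqxx in cb.
Qed.

(** Subtract from a cycle the combination of Boolean cycles with the same values on the suffix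
    chains; the difference is 0 by [cycle_row_eq0]. *)
Lemma eqmx_boolean_mx : (boolean_mx :=: cycles F (@subword_rank n k) m.+1 m)%MS.
Proof.
apply/eqmxP/andP; split.
  by apply/row_subP => a; rewrite rowK; apply: boolean_row_cycle.
have [sa saP] := suffix_elements; apply/row_subP => r.
set z := row r _; have zK : z *m boundary F (@subword_rank n k) m.+1 m = 0.
  by apply/sub_kermxP; apply: row_sub.
pose c : 'rV[F]_#|{: X}| := \row_a z 0 (enum_rank (sa (enum_val a))).
suff -> : z = c *m boolean_mx by apply: submxMl.
pose z' a := (z - c *m boolean_mx) 0 (enum_rank a).
have z'E : \row_a z' (enum_val a) = z - c *m boolean_mx.
  by apply/rowP => a; rewrite mxE /z' enum_valK.
apply/eqP; rewrite -subr_eq0 -z'E; apply/eqP/rowP => b; rewrite !mxE.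
apply: (cycle_row_eq0 lt_mk).
  rewrite z'E mulmxBl zK sub0r -mulmxA.
  rewrite (_ : boolean_mx *m _ = 0) ?mulmx0 ?oppr0 //.
  apply/row_matrixP => a; rewrite row_mul rowK row0.
  exact/sub_kermxP/boolean_row_cycle.
move=> a sm ad; have [sx sz _] := interval_chainP lt_mk a.
have szt : size (word (val a).1) == m.+1 by rewrite sz.
pose t : X := Sub (Tuple szt) sm.
have at_ : px t = (val a).1 by apply: of_wordK.
have asa : a = sa t.
  have [tx td] := saP t; apply: descent_inj; first by rewrite tx.
  by rewrite td at_.
have BE j : boolean_mx j (enum_rank (sa t)) = (enum_val j == t)%:R.
  by rewrite mxE (boolean_row_suffix (sa := sa)).
have zE : (z - c *m boolean_mx) 0 (enum_rank (sa t)) =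
    z 0 (enum_rank (sa t)) - (c *m boolean_mx) 0 (enum_rank (sa t)).
  by rewrite mxE [X in _ + X]mxE.
rewrite /z' asa zE [X in _ - X]mxE (bigD1 (enum_rank t)) //= big1 ?addr0 => [|s st].
  by rewrite BE enum_rankK eqxx mulr1 [c _ _]mxE enum_rankK subrr.
rewrite BE; case: eqP => [est|_]; last by rewrite mulr0.
by rewrite -est enum_valK eqxx in st.
Qed.

Notation IC_action := (interval_chain_action (@subword_act_mono n k)
  (@subword_rank_inv n k) m.+1 m).

Let descent_act (a : IC m.+1 m) g :
  descent (IC_action a g) = [seq subword_action n k y g | y <- descent a].
Proof.
rewrite /descent map_rcons map_rev; congr (rcons _ _).
by apply: word_inj; rewrite // word_act.
Qed.

Let isSome_path (x : P) c : path (@covers n k) x c -> all isSome c.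
Proof. by elim: c x => //= y c IHc x /andP[/and3P[_ _ ->] /IHc]. Qed.

Lemma boolean_row_act (x : P) g : isSome x ->
  boolean_row F m x *m chain_repr F (@subword_act_mono n k) (@subword_rank_inv n k) m.+1 m g =
  boolean_row F m (subword_action n k x g).
Proof.
move=> sx; apply/rowP => r; rewrite perm_act_mxr !mxE enum_rankK.
rewrite -[X in _ = if (val X).1 == _ then _ else _](actKV IC_action g).
rewrite -[X in _ = if _ then boolean_cycle _ _ (descent X) else _](actKV IC_action g).
move: (IC_action (enum_val r) g^-1%g) => a.
rewrite [(val (IC_action a g)).1]/= (inj_eq (act_inj (subword_action n k) g)) descent_act.
case: eqP => // ax; rewrite boolean_cycle_act //.
by have [_ _ /andP[/isSome_path]] := interval_chainP lt_mk a.
Qed.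

Lemma WH_basis : exists b : X -> 'rV[F]_(rdegree WH),
  [/\ forall g t, b t *m WH g = b (smirnov_word_action n m.+1 t g),
      row_free (@family_mx F _ WH X b) & row_full (@family_mx F _ WH X b)].
Proof.
(* No chain of m+1 elements fits strictly between the bottom and an element of rank m+1, so homology
   is the space of cycles. *)
have bnd0 : boundaries F (@subword_rank n k) m.+1 m = 0.
  apply/eqP; rewrite -submx0 genmxE; apply/row_subP => r.
  have /andP[/eqP rx /path_rank] := valP (enum_val r : IC m.+1 m.+1).
  by rewrite last_rcons rx size_rcons size_tuple ltnn.
pose b (t : X) : 'rV[F]_(rdegree WH) := to_section (boundaries F (@subword_rank n k) m.+1 m)
  (cycles F (@subword_rank n k) m.+1 m) (boolean_row F m (px t)).
have famE : @family_mx F _ WH X b = to_section (boundaries F (@subword_rank n k) m.+1 m)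
  (cycles F (@subword_rank n k) m.+1 m) boolean_mx.
  by apply/row_matrixP => a; rewrite row_to_section !rowK.
have rankE : \rank (@family_mx F _ WH X b) = #|{: X}|.
  have sub : (boolean_mx <= cycles F (@subword_rank n k) m.+1 m)%MS.
    by rewrite eqmx_boolean_mx.
  by rewrite famE mxrank_to_section //; apply/eqP/row_free_boolean_mx.
exists b; split.
- move=> g t; rewrite /b px_act -boolean_row_act // to_section_act //.
  + exact: boundaries_module.
  + exact: cycles_module.
  + exact: boolean_row_cycle.
- by apply/eqP.
- rewrite /row_full rankE /= mxrank_section // -eqmx_boolean_mx.
  by rewrite (eqP row_free_boolean_mx).
Qed.

End WhitneyBasis.

(** * Tensor powers of the reflection representation *)

Lemma card_all_tuple (T : finType) (A : {set T}) m :
  #|[set t : m.-tuple T | all (mem A) t]| = (#|A| ^ m)%N.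
Proof.
elim: m => [|m IHm].
  rewrite (eq_card (B := [set: 0.-tuple T])) ?cardsT ?card_tuple // => t.
  by rewrite !inE tuple0.
rewrite (card_tuple_cons _ (fun t => all (mem A) t)) (bigID (mem A)) /=.
rewrite [X in (_ + X)%N]big1 => [|b /negPf bA]; last first.
  by apply: eq_card0 => t; rewrite inE bA.
rewrite addn0 (eq_bigr (fun=> #|A| ^ m)%N) => [|b bA].
  by rewrite sum_nat_const expnS.
by rewrite -IHm; apply: eq_card => t; rewrite !inE bA.
Qed.

Section TensorRows.

Variable F : fieldType.

Lemma tprod_row n1 n2 (u : 'rV[F]_n1) (v : 'rV[F]_n2) : tprod u v = trow u v.
Proof.
apply/rowP => j; rewrite mxE; case: splitP => [i|[]//] _.
rewrite !ord1; congr (trow _ _ _ _).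
by apply/rowP => l; rewrite mxE; congr (u _ _); apply: val_inj.
Qed.

Lemma trow_tprod n1 n2 p1 p2 (u : 'rV[F]_n1) (v : 'rV[F]_n2)
    (A : 'M_(n1, p1)) (B : 'M_(n2, p2)) :
  trow u v *m tprod A B = trow (u *m A) (v *m B).
Proof. by rewrite -!tprod_row (tprodE u A v B). Qed.

Lemma trow_span n1 n2 p q (f : 'M[F]_(n1 * n2, p)) (W : 'M_(q, p)) :
  (forall u (v : 'rV_n2), trow u v *m f <= W)%MS -> (f <= W)%MS.
Proof.
elim: n1 f => [|n1 IHn] f fW; first by rewrite [f]flatmx0 sub0mx.
change 'M[F]_(n2 + n1 * n2, p) in f.
rewrite -[f]vsubmxK -addsmxE addsmx_sub; apply/andP; split.
  apply/row_subP => i; rewrite rowE.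
  have := fW (row_mx 1 0 : 'rV_(1 + n1)) (delta_mx 0 i).
  rewrite /= row_mxKl row_mxKr trow0 mxE scale1r -[f in _ *m f]vsubmxK.
  by rewrite mul_row_col mul0mx addr0.
apply: IHn => u v; have := fW (row_mx 0 u : 'rV_(1 + n1)) v.
rewrite /= row_mxKl row_mxKr mxE scale0r -[f in _ *m f]vsubmxK.
by rewrite mul_row_col mul0mx add0r.
Qed.

End TensorRows.

Section ReflectionTensors.

Variables (F : fieldType) (n : nat).
Notation S := (reflection_rep F n).
Notation T := (tensor_power S).

Definition unit_row (i : 'I_n) : 'rV[F]_#|'I_n| := delta_mx 0 (enum_rank i).

Lemma unit_row_act i (g : 'S_n) : unit_row i *m natural_repr F n g = unit_row (g i).
Proof.
rewrite -rowE; apply/rowP => j; rewrite !mxE enum_rankK eqxx /=.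
by rewrite -(can2_eq enum_rankK enum_valK) eq_sym.
Qed.

Lemma sum_zeroP (w : 'rV[F]_#|'I_n|) :
  reflect (\sum_i w 0 i = 0) (w <= sum_zero F n)%MS.
Proof.
apply: (iffP sub_kermxP) => [/rowP/(_ 0)|w0].
  rewrite !mxE => w0; rewrite -[RHS]w0.
  by apply: eq_bigr => i _; rewrite mxE mulr1.
apply/rowP => j; rewrite !mxE -[RHS]w0.
by apply: eq_bigr => i _; rewrite mxE mulr1.
Qed.

Lemma sum_unit_row i : \sum_j unit_row i 0 j = 1.
Proof.
rewrite (bigD1 (enum_rank i)) //= mxE !eqxx big1 ?addr0 // => j ji.
by rewrite mxE (negPf ji).
Qed.

Lemma unit_row_sum (w : 'rV[F]_#|'I_n|) : w = \sum_i w 0 (enum_rank i) *: unit_row i.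
Proof.
rewrite [LHS]row_sum_delta (reindex _ (onW_bij _ (@enum_rank_bij _))) /=.
by [].
Qed.

Definition diff_row (a i : 'I_n) : 'rV[F]_(rdegree S) :=
  in_submod (sum_zero F n) (unit_row i - unit_row a).

Definition centered_row (a : 'I_n) : 'rV[F]_(rdegree S) :=
  in_submod (sum_zero F n) (unit_row a - n%:R^-1 *: \sum_i unit_row i).

Lemma reflection_act (w : 'rV[F]_#|'I_n|) (g : 'S_n) : (w <= sum_zero F n)%MS ->
  in_submod (sum_zero F n) w *m S g = in_submod (sum_zero F n) (w *m natural_repr F n g).
Proof. by move=> w0; rewrite -(in_submodJ (sum_zero_module F n)). Qed.

Lemma diff_row_act a i (g : 'S_n) : diff_row a i *m S g = diff_row (g a) (g i).
Proof.
rewrite reflection_act; first by rewrite mulmxBl !unit_row_act.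
apply/sum_zeroP; under eq_bigr do rewrite mxE [X in _ + X]mxE.
by rewrite sumrB !sum_unit_row subrr.
Qed.

Hypothesis pchar0 : [pchar F] =i pred0.
Hypothesis n_gt0 : (0 < n)%N.

Let n_neq0 : n%:R != 0 :> F.
Proof. by rewrite (proj1 (pcharf0P F) pchar0) -lt0n. Qed.

Lemma centered_row_act a (g : 'S_n) : centered_row a *m S g = centered_row (g a).
Proof.
rewrite reflection_act.
  rewrite mulmxBl unit_row_act -scalemxAl mulmx_suml; congr (in_submod _ (_ - _ *: _)).
  under eq_bigr do rewrite unit_row_act.
  by rewrite [RHS](reindex_inj (@perm_inj _ g)).
apply/sum_zeroP; under eq_bigr do rewrite mxE [X in _ + X]mxE.
rewrite sumrB sum_unit_row; under [X in _ - X]eq_bigr do rewrite mxE summxE.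
rewrite -mulr_sumr exchange_big /=; under [X in _ * X]eq_bigr do rewrite sum_unit_row.
by rewrite sumr_const card_ord mulVf // subrr.
Qed.

Lemma sum_centered_row : \sum_a centered_row a = 0.
Proof.
rewrite -linear_sum /= sumrB sumr_const [X in _ *+ X]card_ord -scaler_nat scalerA mulfV // scale1r.
by rewrite subrr linear0.
Qed.

(** The coordinates of the vector serve as coefficients: they sum to 0, so the multiples of
    [unit_row a] cancel. *)
Lemma diff_row_span a (v : 'rV[F]_(rdegree S)) :
  exists c : 'I_n -> F, v = \sum_(i | i != a) c i *: diff_row a i.
Proof.
have [w wv] : exists w, val_submod v = w by eexists.
have /sum_zeroP w0 : (w <= sum_zero F n)%MS by rewrite -wv val_submodP.
exists (fun i => w 0 (enum_rank i)); rewrite -[LHS]val_submodK wv.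
rewrite {1}[w]unit_row_sum [X in in_submod _ X](_ : _ =
  \sum_i w 0 (enum_rank i) *: (unit_row i - unit_row a)).
  rewrite linear_sum /= (bigD1 a) //= subrr scaler0 linear0 add0r.
  by apply: eq_bigr => i _; rewrite linearZ.
under [RHS]eq_bigr do rewrite scalerBr.
have {}w0 : \sum_i w 0 (enum_rank i) = 0.
  by rewrite -[RHS]w0 [RHS](reindex _ (onW_bij _ (@enum_rank_bij _))).
by rewrite sumrB -scaler_suml w0 scale0r subr0.
Qed.

Lemma centered_row_span (v : 'rV[F]_(rdegree S)) :
  exists c : 'I_n -> F, v = \sum_a c a *: centered_row a.
Proof.
have [w wv] : exists w, val_submod v = w by eexists.
have /sum_zeroP w0 : (w <= sum_zero F n)%MS by rewrite -wv val_submodP.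
exists (fun i => w 0 (enum_rank i)); rewrite -[LHS]val_submodK wv.
rewrite {1}[w]unit_row_sum [X in in_submod _ X](_ : _ =
  \sum_i w 0 (enum_rank i) *: (unit_row i - n%:R^-1 *: \sum_j unit_row j)).
  by rewrite linear_sum; apply: eq_bigr => i _; rewrite linearZ.
under [RHS]eq_bigr do rewrite scalerBr.
have {}w0 : \sum_i w 0 (enum_rank i) = 0.
  by rewrite -[RHS]w0 [RHS](reindex _ (onW_bij _ (@enum_rank_bij _))).
by rewrite sumrB -scaler_suml w0 scale0r subr0.
Qed.

Lemma rdegree_reflection : rdegree S = n.-1.
Proof.
rewrite /= mxrank_ker card_ord -subn1; congr (_ - _)%N.
apply/eqP; rewrite eqn_leq rank_leq_col lt0n mxrank_eq0.
by apply/eqP => /matrixP/(_ (Ordinal n_gt0) 0)/eqP; rewrite !mxE oner_eq0.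
Qed.

Lemma rdegree_tensor m : rdegree (T m) = (n.-1 ^ m)%N.
Proof.
by elim: m => // m IHm; rewrite [LHS]/= -/(rdegree _) IHm -rdegree_reflection expnS.
Qed.

(** The default [a] of [head] is reached only when [s] has fewer than m letters; the factor is then
    0. *)
Fixpoint diff_tensor m a (s : seq 'I_n) : 'rV[F]_(rdegree (T m)) :=
  if m is m'.+1 return 'rV[F]_(rdegree (T m))
  then trow (diff_row a (head a s)) (diff_tensor m' a (behead s)) else 1%:M.

Lemma diff_tensor_act m a s (g : 'S_n) :
  diff_tensor m a s *m T m g = diff_tensor m (g a) (map g s).
Proof.
elim: m s => [|m IHm] s /=; first by rewrite mulmx1.
rewrite trow_tprod diff_row_act IHm.
by case: s => [|i s].
Qed.

Lemma diff_tensor_span m a p q (f : 'M[F]_(rdegree (T m), p)) (W : 'M_(q, p)) :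
    (forall s, size s = m -> a \notin s -> diff_tensor m a s *m f <= W)%MS ->
  (f <= W)%MS.
Proof.
elim: m f => [|m IHm] f fW; first by have := fW [::] erefl isT; rewrite mul1mx.
apply: trow_span => u t; have [c ->] := diff_row_span a u.
rewrite -trowbE linear_sum mulmx_suml summx_sub // => i ia.
rewrite linearZ -scalemxAl scalemx_sub //= trowbE.
(* [L] is tensoring with the first factor, so the induction hypothesis applies to [L *m f]. *)
pose L : 'M[F]_(rdegree (T m), _) := lin1_mx (@trow F _ (diff_row a i) 1 (rdegree (T m))).
have LE (v : 'rV_(rdegree (T m))) : v *m (L *m f) = trow (diff_row a i) v *m f.
  by rewrite mulmxA mul_rV_lin1.
rewrite -LE mulmx_sub // IHm // => s sz sa; rewrite LE.
by apply: (fW (i :: s)); rewrite /= ?sz // inE negb_or eq_sym ia.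
Qed.

(** The index set of the permuted basis of S^(m+1) + S^m. Each permutation fixes as many of these as
    Smirnov words of length m+1. *)
Definition pointed_word (m : nat) : predArgType :=
  {p : 'I_n * m.-tuple 'I_n | p.1 \notin p.2}.
HB.instance Definition _ m := Finite.on (pointed_word m).

Fact pointed_word_act_proof m (p : pointed_word m) (g : 'S_n) :
  g (val p).1 \notin map_tuple g (val p).2.
Proof. by rewrite mem_map; [apply: (valP p) | apply: perm_inj]. Qed.

Definition pointed_word_act m (p : pointed_word m) (g : 'S_n) : pointed_word m :=
  Sub (g (val p).1, map_tuple g (val p).2) (pointed_word_act_proof p g).

Fact pointed_word_is_action m : is_action [set: 'S_n] (@pointed_word_act m).
Proof.
apply: is_total_action => [p|p g h]; apply: val_inj => /=.
  case: (val p) => a t /=; rewrite perm1; congr pair; apply: val_inj => /=.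
  by rewrite (eq_map (g := id)) ?map_id // => i; rewrite perm1.
rewrite permM; congr pair; apply: val_inj => /=.
by rewrite -map_comp; apply: eq_map => i; rewrite permM.
Qed.

Definition pointed_word_action m : {action 'S_n &-> pointed_word m} :=
  Action (@pointed_word_is_action m).

Lemma card_fixed_pointed m (w : 'S_n) :
  #|[set p : pointed_word m | pointed_word_action m p w == p]| =
  (fixpoints w * (fixpoints w).-1 ^ m)%N.
Proof.
pose A := [set i | w i == i].
transitivity (\sum_(a in A) #|[set t : m.-tuple 'I_n | all (mem (A :\ a)) t]|)%N.
  rewrite -(card_imset _ val_inj) -sum1_card.
  rewrite (eq_bigr (fun a => \sum_(t : m.-tuple 'I_n | all (mem (A :\ a)) t) 1)%N); last first.
    by move=> a _; rewrite -sum1_card; apply: eq_bigl => t; rewrite inE.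
  rewrite pair_big_dep /=; apply: eq_bigl => -[a t] /=; apply/imsetP/andP => [[p]|[aA /allP tA]].
    case: p => -[b u] nat_; rewrite inE => /eqP/(congr1 val)/= [wa wt] [-> ->].
    rewrite /= in nat_; split; first by rewrite inE wa.
    apply/allP => i it; rewrite /= !inE (memPn nat_) //=.
    by apply/eqP/(proj2 (eq_in_map w id u)) => //; rewrite map_id -[RHS](congr1 (@tval _ _) wt).
  have nat_ : a \notin t by apply/negP => /tA; rewrite /= !inE eqxx.
  exists (Sub (a, t) nat_ : pointed_word m) => //; rewrite inE; apply/eqP/val_inj => /=.
  rewrite inE in aA; rewrite (eqP aA); congr pair; apply: val_inj => /=.
  by apply: map_id_in => i /tA; rewrite /= !inE => /andP[_ /eqP].
under eq_bigr => a aA do rewrite card_all_tuple.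
rewrite (eq_bigr (fun=> #|A|.-1 ^ m)%N) => [|a aA]; first by rewrite sum_nat_const.
by rewrite (cardsD1 a A) aA.
Qed.

Notation V m := (dadd_grepr (T m.+1) (T m)).

Definition pointed_row m (p : pointed_word m) : 'rV[F]_(rdegree (V m)) :=
  row_mx (trow (centered_row (val p).1) (diff_tensor m (val p).1 (val p).2))
         (diff_tensor m (val p).1 (val p).2).

Lemma pointed_row_act m g (p : pointed_word m) :
  pointed_row p *m V m g = pointed_row (pointed_word_action m p g).
Proof.
rewrite /pointed_row /= mul_row_block !mulmx0 addr0 add0r trow_tprod.
by rewrite centered_row_act diff_tensor_act.
Qed.

(** For fixed t, summing (u_a (x) t, t) over a gives n (0, t), because the u_a sum to 0. So every
    (0, t) is in the span, by subtraction every (u_a (x) t, 0), and the u_a span. *)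
Lemma pointed_row_full m : row_full (@family_mx F _ (V m) (pointed_word m) (@pointed_row m)).
Proof.
set W := family_mx _.
have rowW (p : pointed_word m) : (pointed_row p <= W)%MS.
  by rewrite (_ : pointed_row p = row (enum_rank p) W) ?row_sub // rowK enum_rankK.
(* For each a the tensors of differences span, so [t] can be taken arbitrary and the same for all
   a. *)
have diagW a (t : 'rV_(rdegree (T m))) : (row_mx (trow (centered_row a) t) t <= W)%MS.
  pose L : 'M[F]_(rdegree (T m), _) := lin1_mx (@trow F _ (centered_row a) 1 (rdegree (T m))).
  have LE (v : 'rV_(rdegree (T m))) :
      v *m row_mx L 1%:M = row_mx (trow (centered_row a) v) v.
    by rewrite mul_mx_row mulmx1 mul_rV_lin1.
  rewrite -LE mulmx_sub //; apply: (@diff_tensor_span m a) => s /eqP sz sa.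
  by rewrite LE; apply: (rowW (Sub (a, Tuple sz) sa)).
have left_mx (t : 'rV[F]_(rdegree (T m))) : exists L, forall v : 'rV[F]_(rdegree S),
    v *m L = row_mx (trow v t) (0 : 'rV[F]_(rdegree (T m))).
  pose L := lin1_mx (@trowb F (rdegree S) 1 _ t).
  by exists (row_mx L 0) => v; rewrite mul_mx_row mulmx0 mul_rV_lin1.
have rightW (t : 'rV[F]_(rdegree (T m))) : (row_mx (0 : 'rV[F]_(rdegree (T m.+1))) t <= W)%MS.
  have [L LE] := left_mx t; set r := row_mx _ t.
  have : ((\sum_a row_mx (trow (centered_row a) t) t)%R <= W)%MS by apply: summx_sub.
  rewrite (eq_bigr (fun a => centered_row a *m L + r)) => [|a _]; last first.
    by rewrite LE add_row_mx addr0 add0r.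
  rewrite big_split /= -mulmx_suml sum_centered_row mul0mx add0r sumr_const [X in _ *+ X]card_ord.
  by rewrite -scaler_nat eqmx_scale.
have leftW (t : 'rV[F]_(rdegree (T m))) u :
    (row_mx (trow u t) (0 : 'rV[F]_(rdegree (T m))) <= W)%MS.
  have [L LE] := left_mx t; have [c uE] := centered_row_span u.
  rewrite -LE uE mulmx_suml summx_sub // => a _; rewrite -scalemxAl scalemx_sub // LE.
  have -> : row_mx (trow (centered_row a) t) 0 =
      row_mx (trow (centered_row a) t) t - row_mx (0 : 'rV[F]_(rdegree (T m.+1))) t.
    by rewrite opp_row_mx add_row_mx oppr0 addr0 subrr.
  by rewrite addmx_sub // eqmx_opp.
have leftW1 : (row_mx (1%:M : 'M[F]_(rdegree (T m.+1))) (0 : 'M[F]_(_, rdegree (T m))) <= W)%MS.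
  by apply: trow_span => u t; rewrite mul_mx_row mulmx1 mulmx0.
rewrite -sub1mx; apply/row_subP => i; move: (row i _) => v.
change 'rV[F]_(rdegree (T m.+1) + rdegree (T m)) in v.
rewrite -[v]hsubmxK -[lsubmx v]addr0 -[rsubmx v]add0r -add_row_mx addmx_sub //.
by rewrite -[lsubmx v]mulmx1 -[0](mulmx0 _ (lsubmx v)) -mul_mx_row mulmx_sub.
Qed.

(** A dimension count: the identity fixes n (n-1)^m pointed words, and this is (n-1)^(m+1) +
    (n-1)^m. *)
Lemma pointed_row_free m : row_free (@family_mx F _ (V m) (pointed_word m) (@pointed_row m)).
Proof.
rewrite /row_free (eqP (pointed_row_full m)); apply/eqP.
rewrite [LHS]/= -!/(rdegree _) [LHS](_ : _ = rdegree S * rdegree (T m) + rdegree (T m))%N //.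
rewrite rdegree_tensor rdegree_reflection.
have := card_fixed_pointed m 1; rewrite (eq_card (B := {: pointed_word m})) => [->|p].
  rewrite /fixpoints (eq_card (B := 'I_n)) ?card_ord => [|i]; last by rewrite inE perm1 eqxx.
  by case: n n_gt0 => // l _; rewrite mulSn addnC.
by rewrite inE act1 eqxx.
Qed.

End ReflectionTensors.

(** * The main theorem *)

Lemma young_subgroup_of_word n (s : seq 'I_n) :
  is_young_subgroup ((n - size (undup s))%N :: nseq (size (undup s)) 1%N)
    [set w : 'S_n | map w s == s].
Proof.
have us := undup_uniq s; set u := undup s in us *.
have su x : (x \in s) = (x \in u) by rewrite mem_undup.
(* The letters of [s] get distinct positive labels and all others the label 0: one block of size n -
   d and d singletons. *)
pose f x := if x \in u then (index x u).+1 else 0%N.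
exists f; split=> [[|i]|] /=.
- rewrite -(card_uniqP us) -[X in (X - _)%N]card_ord -(cardC (mem u)) addKn.
  by apply: eq_card => x; rewrite !inE /f; case: ifP.
- rewrite nth_nseq; case: ltnP => iu; last first.
    apply: eq_card0 => x; rewrite inE /f; case: ifP => // xu.
    by rewrite eqSS; apply: contra_leqF iu => /eqP <-; rewrite index_mem.
  have x0 : 'I_n by case: (u) iu.
  apply/eqP/cards1P; exists (nth x0 u i); apply/setP => x; rewrite !inE /f.
  case: ifP => [xu|xu].
    rewrite eqSS; apply/eqP/eqP => [<-|->]; first by rewrite nth_index.
    by rewrite index_uniq.
  by apply/esym/eqP => xE; rewrite xE mem_nth in xu.
apply/setP => w; rewrite !inE.
have fixP : (map w s == s) = [forall x in u, w x == x].
  apply/eqP/forall_inP => [ws x|wu]; last first.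
    by apply: map_id_in => x; rewrite su => /wu/eqP.
  rewrite -su => xs; apply/eqP/(proj2 (eq_in_map w id s)) => //.
  by rewrite map_id.
rewrite fixP; apply/forall_inP/forallP => [wu x|wf x xu].
  rewrite /f; case: ifP => wx; last by case: ifP => // xu; rewrite (eqP (wu x xu)) xu in wx.
  by have /eqP/perm_inj wxx := wu _ wx; rewrite wxx in wx *; rewrite wx.
have := wf x; rewrite /f xu; case: ifP => // wxu; rewrite eqSS => /eqP wx.
by rewrite -(nth_index x wxu) wx nth_index.
Qed.

Section Assembly.

Variables (F : fieldType) (n k N : nat).
Hypotheses (pchar0 : [pchar F] =i pred0) (N_gt0 : (0 < N)%N) (n_gt0 : (0 < n)%N).

Lemma ch_triv : ch N (triv_rep F 'S_n) = hsym F N n.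
Proof.
rewrite -(frob1 pchar0 N_gt0); congr frob; apply/ffunP => w.
by rewrite !ffunE /= mxtrace1.
Qed.

Lemma triv_permutation_module (gT : finGroupType) : is_permutation_module (triv_rep F gT).
Proof.
by exists 1%:M; split=> [|g i]; [apply: unitmx1 | exists i; rewrite mulmx1].
Qed.

Lemma ch_WH m : (m < k)%N -> ch N (subword_WH F n k m.+1) = frob N (smirnov_character F n m).
Proof.
move=> mk; have [b [b_act b_free b_full]] := WH_basis F n mk.
congr frob; apply/ffunP => w; rewrite !ffunE.
by rewrite (permuted_family_trace b_act b_free b_full) card_fixed_smirnov.
Qed.

Lemma WH_permutation_module m : (m < k)%N -> is_permutation_module (subword_WH F n k m.+1).
Proof.
move=> mk; have [b [b_act b_free b_full]] := WH_basis F n mk.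
by have [B [BP _]] := permuted_family_basis b_act b_free b_full; exists B.
Qed.

Lemma WH_hook_module m : (m < k)%N -> is_hook_permutation_module (subword_WH F n k m.+1).
Proof.
move=> mk; have [b [b_act b_free b_full]] := WH_basis F n mk.
have [B [BP Bb]] := permuted_family_basis b_act b_free b_full.
exists B; split=> // i; have [t ->] := Bb i; set s := val (val t).
exists (size (undup s)).
  by rewrite -(card_uniqP (undup_uniq s)) -[X in (_ <= X)%N]card_ord max_card.
(* Distinct words give distinct basis vectors, so a vector and its word have the same stabiliser. *)
have -> : rstab (subword_WH F n k m.+1) (b t) = [set w : 'S_n | map w s == s].
  apply/setP => w; rewrite !inE b_act /= (inj_eq (permuted_family_inj b_free)).
  by [].
exact: young_subgroup_of_word.
Qed.

Lemma ch_reflection_sum m :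
  ch N (dadd_grepr (tensor_power (reflection_rep F n) m.+1)
                   (tensor_power (reflection_rep F n) m)) =
  frob N (smirnov_character F n m).
Proof.
congr frob; apply/ffunP => w; rewrite !ffunE.
rewrite (permuted_family_trace (pointed_row_act pchar0 n_gt0 (m := m))
  (pointed_row_free pchar0 n_gt0 m) (pointed_row_full pchar0 n_gt0 m)).
by rewrite card_fixed_pointed.
Qed.

Lemma reflection_sum_permutation_module m :
  is_permutation_module (dadd_grepr (tensor_power (reflection_rep F n) m.+1)
                                    (tensor_power (reflection_rep F n) m)).
Proof.
have [B [BP _]] := permuted_family_basis (pointed_row_act pchar0 n_gt0 (m := m))
  (pointed_row_free pchar0 n_gt0 m) (pointed_row_full pchar0 n_gt0 m).
by exists B.
Qed.

End Assembly.

Theorem proposition38 (R : realType) (n k N : nat)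
    (n_ge2 : (2 <= n)%N) (k_ge1 : (1 <= k)%N) (N_ge_n : (n <= N)%N) :
  let C : fieldType := R[i] in
  let h := @hsym C N in
  let WH := subword_WH C n k in
  let S := reflection_rep C n in
  let s := @schur C N [:: n.-1; 1%N] in
  [/\ forall j : nat, (j <= k)%N ->
        h_positive n (ch N (WH j)) /\ is_permutation_module (WH j),
      forall j : nat, (1 <= j <= k)%N ->
        let V := dadd_grepr (tensor_power S j) (tensor_power S j.-1) in
        h_positive n (ch N V) /\ is_permutation_module V,
      ch N (WH 0%N) = h n,
      ch N (WH 1%N) = h 1 * h (n%:Z - 1)
    & forall j : nat, (2 <= j <= k)%N ->
        [/\ ch N (WH j) = kron n (h 1 * h (n%:Z - 1)) (kron_pow n s j.-1),
            kron n (h 1 * h (n%:Z - 1)) (kron_pow n s j.-1) =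
            \sum_(2 <= d < j.+1)
              (stirling2 j.-1 d.-1)%:R *: (h 1 ^+ d * h (n%:Z - d%:Z)),
            \sum_(2 <= d < j.+1)
              (stirling2 j.-1 d.-1)%:R *: (h 1 ^+ d * h (n%:Z - d%:Z)) =
            \sum_(2 <= d < j.+1)
              (stirling2_star j d)%:R *: (h 1 ^+ d * h (n%:Z - d%:Z)),
            \sum_(2 <= d < j.+1)
              (stirling2_star j d)%:R *: (h 1 ^+ d * h (n%:Z - d%:Z)) =
            h 1 * kron_pow n.-1 (h 1 * h (n%:Z - 2)) j.-1
          & is_hook_permutation_module (WH j)]].
Proof.
move=> C h WH S s; have pchar0 : [pchar C] =i pred0 by apply: pchar_num.
have n_gt0 : (0 < n)%N := ltnW n_ge2; have N_gt0 := leq_trans n_gt0 N_ge_n.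
split=> [[|m] mk|[//|m] mk V|||[|[|m]] //= mk].
- rewrite [ch _ _](ch_triv n pchar0 N_gt0); split; first exact: h_positive_hsym.
  exact: triv_permutation_module.
- rewrite [ch _ _]ch_WH //; split; first exact: h_positive_smirnov.
  exact: WH_permutation_module.
- rewrite [ch _ _]ch_reflection_sum //; split; first exact: h_positive_smirnov.
  exact: reflection_sum_permutation_module.
- exact: ch_triv.
- rewrite [LHS]ch_WH // -[RHS]frob_fix //; congr frob; apply/ffunP => w.
  by rewrite !ffunE muln1.
have nK : n.-1.+1 = n := prednK n_gt0; have lt_nN : (n.-1 < N)%N by rewrite nK.
(* All the formulas for j >= 2 are compared with the characteristic of [smirnov_character]. *)
have kronE : kron n (h 1 * h (n%:Z - 1)) (kron_pow n s m.+1) =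
    frob N (smirnov_character C n m.+1).
  have := @kron_smirnov C N pchar0 N_gt0 n.-1 m.+1; rewrite nK; apply=> //.
  by rewrite -ltnS nK.
split.
- by rewrite kronE [LHS]ch_WH.
- by rewrite kronE hook_sumE.
- by rewrite hook_sumE // hook_sum_starE.
(* The internal power lives in degree n-1, so the index n-2 is one less than its degree. *)
- have -> : n%:Z - 2 = n.-1%:Z - 1 by rewrite -[in LHS]nK intS opprD addrACA subrr add0r.
  have := @hsym1_kron_pow C N pchar0 N_gt0 n.-1 m.+1 lt_nN; rewrite nK => ->.
  by rewrite hook_sum_starE.
exact: WH_hook_module.
Qed.
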